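(* Let $\mathbf{k}$ be an algebraically closed field of characteristic zero and let $\Delta$ be a simplicial complex on $[n]$. (a) The standard torus $T_0=(\mathbf k^* )^n$ embeds into $\operatorname{Aut}(X_\Delta)$ as a closed algebraic subgroup. (b) Every algebraic torus $D\subseteq\operatorname{Aut}(X_\Delta)$ satisfies $\dim D\le n$. (c) Every algebraic torus of dimension $n$ in $\operatorname{Aut}(X_\Delta)$ is conjugate to $T_0$.
   Context: $\mathbf{k}$ is an algebraically closed field of characteristic zero. For $n\ge 1$, $[n]=\{1,\dots,n\}$. A simplicial complex $\Delta$ on $[n]$ is a collection of subsets of $[n]$ (faces) closed under taking subsets; it is always assumed that $\{i\}\in\Delta$ for every $i\in[n]$. $\mathbf k[\Delta]=\mathbf k[x_1,\dots,x_n]/I_\Delta$ with $I_\Delta=(\prod_{i\in\sigma}x_i:\sigma\subseteq[n],\sigma\notin\Delta)$, $X_\Delta=\operatorname{Spec}\mathbf k[\Delta]$, and $\overline{x}_i$ is the class of $x_i$. Ind-groups: an ind-variety is a set $\mathcal V$ with an ascending filtration $\mathcal V_0\subseteq\mathcal V_1\subseteq\cdots$ with union $\mathcal V$, each $\mathcal V_k$ an algebraic variety (not necessarily irreducible) and each inclusion a closed immersion; morphisms are maps sending each filtration piece into some filtration piece by a morphism of varieties. An ind-group is a group with an ind-variety structure for which multiplication and inversion are morphisms. $\operatorname{Aut}(X_\Delta)=\operatorname{Aut}_{\mathbf k}(\mathbf k[\Delta])$ is an ind-group: $\varphi$ is identified with $(\varphi,\varphi^{-1})$, each endomorphism being given by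 the tuple of images of $\overline x_1,\dots,\overline x_n$, and the $d$-th filtration piece consists of pairs for which $\varphi$ and $\varphi^{-1}$ both send every $\overline{x}_l$ to an element of total degree at most $d$ (a closed subvariety of a finite-dimensional vector space). An algebraic subgroup of an ind-group $\mathcal G=\bigcup_k\mathcal G_k$ is a subgroup that is a closed algebraic subvariety of some $\mathcal G_k$; an (algebraic) torus in $\mathcal G$ is an algebraic subgroup isomorphic to some $(\mathbf k^* )^m$. $T_0=(\mathbf k^* )^n$ is embedded in $\operatorname{Aut}(X_\Delta)$ via $t\cdot \overline x_i=t_i\overline x_i$. *)

(* Defs.v *)
From HB Require Import structures.
From mathcomp Require Import all_boot all_order all_algebra.
From mathcomp Require Import ring_quotient mpoly boolp.

Set Implicit Arguments.
Unset Strict Implicit.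
Unset Printing Implicit Defensive.

Import GRing.Theory.
Local Open Scope ring_scope.
Local Open Scope quotient_scope.

(* An affine variety in the classical language: a subset [av_set] of [T],
   placed in the affine space k^[av_idx] by the coordinate functions
   [av_coord]. The record does not carry the requirement that these embed
   [av_set] as a Zariski closed subset; it holds for the varieties used
   below. *)
Record affvar (k : fieldType) (T : Type) := AffVar {
  av_set :> T -> Prop;
  av_idx : finType;
  av_coord : av_idx -> T -> k
}.

Section Varieties.
Variable k : fieldType.

Definition av_eval T (X : affvar k T) (P : {mpoly k[#|av_idx X|]}) (x : T) : k :=
  P.@[fun i => av_coord (enum_val i) x].

Definition regular T (X : affvar k T) (f : T -> k) : Prop :=
  exists P : {mpoly k[#|av_idx X|]}, forall x, X x -> f x = av_eval P x.

Definition morphism T U (X : affvar k T) (Y : affvar k U) (h : T -> U) : Prop :=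
  (forall x, X x -> Y (h x)) /\
  (forall j : av_idx Y, regular X (fun x => av_coord j (h x))).

Definition closed_subset T (X : affvar k T) (Z : T -> Prop) : Prop :=
  exists S : {mpoly k[#|av_idx X|]} -> Prop,
    forall x, Z x <-> X x /\ (forall P, S P -> av_eval P x = 0).

Definition subvariety T (X : affvar k T) (Z : T -> Prop) : affvar k T :=
  AffVar Z (@av_coord k T X).

Definition irreducible_closed T (X : affvar k T) (Z : T -> Prop) : Prop :=
  [/\ closed_subset X Z,
      exists x, Z x
    & forall Z1 Z2 : T -> Prop, closed_subset X Z1 -> closed_subset X Z2 ->
        (forall x, Z x -> Z1 x \/ Z2 x) ->
        (forall x, Z x -> Z1 x) \/ (forall x, Z x -> Z2 x)].

Definition has_chain T (X : affvar k T) (d : nat) : Prop :=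
  exists Z : nat -> T -> Prop,
    (forall i, (i <= d)%N -> irreducible_closed X (Z i)) /\
    (forall i, (i < d)%N ->
       (forall x, Z i x -> Z i.+1 x) /\ (exists x, Z i.+1 x /\ ~ Z i x)).

(* Krull dimension of the Zariski topology. *)
Definition dim_le T (X : affvar k T) (d : nat) : Prop :=
  forall e, has_chain X e -> (e <= d)%N.

Definition has_dim T (X : affvar k T) (d : nat) : Prop :=
  has_chain X d /\ dim_le X d.

End Varieties.

(* G is an ind-group with d-th filtration piece F d. An algebraic subgroup H
   closed in F d is given the variety structure subvariety (F d) H; since
   F d is closed in F d.+1, it does not depend on d. *)
Section AlgebraicSubgroups.
Variables (k : fieldType) (G : groupType) (F : nat -> affvar k G).
Local Open Scope group_scope.

Definition is_subgroup (H : G -> Prop) : Prop :=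
  [/\ H 1, forall g h, H g -> H h -> H (g * h) & forall g, H g -> H g^-1].

Definition alg_subgroup (d : nat) (H : G -> Prop) : Prop :=
  is_subgroup H /\ closed_subset (F d) H.

Definition conjugate (H K : G -> Prop) : Prop :=
  exists g : G, forall h, H h <-> exists2 x, K x & h = g * x * g^-1.

End AlgebraicSubgroups.

Definition alg_group_iso (k : fieldType) (G1 G2 : groupType)
    (X : affvar k G1) (Y : affvar k G2) (h : G1 -> G2) : Prop :=
  [/\ forall x y, X x -> X y -> h (x * y)%g = (h x * h y)%g,
      morphism X Y h
    & exists h' : G2 -> G1,
        [/\ morphism Y X h', forall x, X x -> h' (h x) = x
          & forall y, Y y -> h (h' y) = y]].

Definition kstar (k : fieldType) := {x : k | x != 0}.

Section Kstar.
Variable k : fieldType.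

Definition kstar_one : kstar k := exist _ 1 (oner_neq0 k).
Definition kstar_mul (x y : kstar k) : kstar k :=
  exist _ (val x * val y) (mulf_neq0 (valP x) (valP y)).
Definition kstar_inv (x : kstar k) : kstar k :=
  exist _ (val x)^-1 (invr_neq0 (valP x)).

Lemma kstar_mulA : associative kstar_mul.
Proof. by move=> x y z; apply: val_inj; rewrite /= mulrA. Qed.
Lemma kstar_mul1 : left_id kstar_one kstar_mul.
Proof. by move=> x; apply: val_inj; rewrite /= mul1r. Qed.
Lemma kstar_1mul : right_id kstar_one kstar_mul.
Proof. by move=> x; apply: val_inj; rewrite /= mulr1. Qed.
Lemma kstar_mulV : left_inverse kstar_one kstar_inv kstar_mul.
Proof. by move=> x; apply: val_inj; rewrite /= mulVf ?(valP x). Qed.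
Lemma kstar_Vmul : right_inverse kstar_one kstar_inv kstar_mul.
Proof. by move=> x; apply: val_inj; rewrite /= mulfV ?(valP x). Qed.

HB.instance Definition _ := Choice.on (kstar k).
HB.instance Definition _ := isGroup.Build (kstar k)
  kstar_mulA kstar_mul1 kstar_1mul kstar_mulV kstar_Vmul.

Definition torus (m : nat) : groupType := {ffun 'I_m -> kstar k}.

(* The coordinates are the t_i and the t_i^-1, so that kstar^m is closed in
   k^(2m) and its regular functions are the Laurent polynomials. *)
Definition torus_var (m : nat) : affvar k (torus m) :=
  @AffVar k (torus m) (fun _ => True) ('I_m + 'I_m)%type
    (fun j t => match j with
                | inl i => val (t i)
                | inr i => (val (t i))^-1
                end).

Definition is_torus (G : groupType) (F : nat -> affvar k G) (d : nat)
    (D : G -> Prop) : Prop :=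
  alg_subgroup F d D /\
  exists m, exists h : torus m -> G,
    alg_group_iso (torus_var m) (subvariety (F d) D) h.

End Kstar.

Record algaut (k : nzRingType) (A : algType k) := AlgAut {
  aut_fun :> {lrmorphism A -> A};
  aut_inv : {lrmorphism A -> A};
  aut_funK : cancel aut_fun aut_inv;
  aut_invK : cancel aut_inv aut_fun
}.

Section AlgAut.
Variables (k : nzRingType) (A : algType k).

Lemma lrmorphism_ext (f g : {lrmorphism A -> A}) : f =1 g -> f = g.
Proof.
case: f => f cf; case: g => g cg /= /funext fg.
case: _ / fg in cg *; congr GRing.LRMorphism.Pack.
by case: cf => [[?] [?] [?]]; case: cg => [[?] [?] [?]]; 
  congr GRing.LRMorphism.Class;
  do ?[congr GRing.isNmodMorphism.Axioms_ | congr GRing.isMonoidMorphism.Axioms_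
      | congr GRing.isScalable.Axioms_]; exact: Prop_irrelevance.
Qed.

Lemma algaut_ext (f g : algaut A) : (forall x, f x = g x) -> f = g.
Proof.
case: f => f f' fK f'K; case: g => g g' gK g'K /= /lrmorphism_ext fg.
subst g; have /lrmorphism_ext fg' : f' =1 g'.
  by move=> x; rewrite -[x in LHS]g'K fK.
by subst g'; congr AlgAut; exact: Prop_irrelevance.
Qed.

HB.instance Definition _ := gen_eqMixin (algaut A).
HB.instance Definition _ := gen_choiceMixin (algaut A).

Definition algaut_one : algaut A :=
  @AlgAut k A (idfun : {lrmorphism A -> A}) (idfun : {lrmorphism A -> A})
    (fun _ => erefl) (fun _ => erefl).
Definition algaut_inv (f : algaut A) : algaut A :=
  AlgAut (@aut_invK k A f) (@aut_funK k A f).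
Definition algaut_mul (f g : algaut A) : algaut A :=
  @AlgAut k A (f \o g : {lrmorphism A -> A})
    (aut_inv g \o aut_inv f : {lrmorphism A -> A})
    (can_comp (@aut_funK _ _ f) (@aut_funK _ _ g))
    (can_comp (@aut_invK _ _ g) (@aut_invK _ _ f)).

Lemma algaut_mulA : associative algaut_mul.
Proof. by move=> f g h; apply: algaut_ext. Qed.
Lemma algaut_mul1 : left_id algaut_one algaut_mul.
Proof. by move=> f; apply: algaut_ext. Qed.
Lemma algaut_1mul : right_id algaut_one algaut_mul.
Proof. by move=> f; apply: algaut_ext. Qed.
Lemma algaut_mulV : left_inverse algaut_one algaut_inv algaut_mul.
Proof. by move=> f; apply: algaut_ext => x /=; rewrite aut_funK. Qed.
Lemma algaut_Vmul : right_inverse algaut_one algaut_inv algaut_mul.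
Proof. by move=> f; apply: algaut_ext => x /=; rewrite aut_invK. Qed.

HB.instance Definition _ := isGroup.Build (algaut A)
  algaut_mulA algaut_mul1 algaut_1mul algaut_mulV algaut_Vmul.

End AlgAut.

(* The index set [n] is 'I_n, and n >= 1 is part of the structure: together
   with the last field it makes set0 a face, so that k[Delta] is nonzero. *)
Record simplicial_complex (n : nat) := SimplicialComplex {
  faces :> {set {set 'I_n}};
  sc_gt0 : (0 < n)%N;
  sc_closed : forall s t : {set 'I_n}, t \subset s -> s \in faces -> t \in faces;
  sc_vertex : forall i : 'I_n, [set i] \in faces
}.

Section StanleyReisner.
Variables (k : fieldType) (n : nat) (Delta : simplicial_complex n).

Definition sqfree_mono (s : {set 'I_n}) : {mpoly k[n]} := \prod_(i in s) 'X_i.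

Definition SRideal : {pred {mpoly k[n]}} := fun p =>
  `[< exists c : {set 'I_n} -> {mpoly k[n]},
        p = \sum_(s : {set 'I_n} | s \notin faces Delta) c s * sqfree_mono s >].

Definition msupport (m : 'X_{1..n}) : {set 'I_n} := [set i | m i != 0%N].

Lemma sqfree_monoE (s : {set 'I_n}) :
  sqfree_mono s = 'X_[\sum_(i in s) U_(i)%MM].
Proof. by rewrite /sqfree_mono mprodXE. Qed.

Lemma mcoeff_sqfree_mul (q : {mpoly k[n]}) (s : {set 'I_n}) m :
  ~~ (s \subset msupport m) -> (q * sqfree_mono s)@_m = 0.
Proof.
move=> nsm; apply: memN_msupp_eq0; apply: contra nsm.
rewrite sqfree_monoE (perm_mem (msuppMX _ _)) => /mapP[m' _ ->].
apply/subsetP => i i_s; rewrite inE mnmDE mnm_sumE (bigD1 i) //= mnm1E eqxx.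
by [].
Qed.

Lemma SRideal_mcoeff p m :
  p \in SRideal -> msupport m \in faces Delta -> p@_m = 0.
Proof.
move=> /asboolP[c ->] mD; rewrite raddf_sum big1 //= => s sD.
apply: mcoeff_sqfree_mul; apply: contra sD => sm.
exact: sc_closed sm mD.
Qed.

Lemma set0_face : set0 \in faces Delta.
Proof. exact: sc_closed (sub0set _) (sc_vertex Delta (Ordinal (sc_gt0 Delta))). Qed.

Lemma SRideal_closed : idealr_closed SRideal.
Proof.
split.
- by apply/asboolP; exists (fun _ => 0); rewrite big1 // => s _; rewrite mul0r.
- apply/negP => /(@SRideal_mcoeff _ 0%MM) H.
  have: msupport 0%MM \in faces Delta.
    rewrite (_ : msupport _ = set0) ?set0_face //.
    by apply/setP => i; rewrite !inE mnm0E.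
  by move/H/eqP; rewrite mcoeff1 eqxx oner_eq0.
- move=> a u v /asboolP[c ->] /asboolP[c' ->]; apply/asboolP.
  exists (fun s => a * c s + c' s); rewrite mulr_sumr -big_split /=.
  by apply: eq_bigr => s _; rewrite mulrDl mulrA.
Qed.

HB.instance Definition _ := isIdealr.Build {mpoly k[n]} SRideal SRideal_closed.

Definition SRring := {ideal_quot SRideal}.
HB.instance Definition _ := GRing.ComNzRing.on SRring.
HB.instance Definition _ := NzRingQuotient.on SRring.

Definition SRpi (p : {mpoly k[n]}) : SRring := \pi_SRring p.
HB.instance Definition _ := GRing.RMorphism.copy SRpi (\pi_SRring : _ -> _).

Definition SRscale (c : k) (a : SRring) : SRring := SRpi c%:MP * a.

Fact SRscaleA c d a : SRscale c (SRscale d a) = SRscale (c * d) a.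
Proof. by rewrite /SRscale mulrA -rmorphM /= mpolyCM. Qed.
Fact SRscale1 : left_id 1 SRscale.
Proof. by move=> a; rewrite /SRscale mpolyC1 rmorph1 mul1r. Qed.
Fact SRscaleDr : right_distributive SRscale +%R.
Proof. by move=> c a b; rewrite /SRscale mulrDr. Qed.
Fact SRscaleDl a : {morph SRscale^~ a : c d / c + d}.
Proof. by move=> c d; rewrite /SRscale mpolyCD rmorphD mulrDl. Qed.
HB.instance Definition _ := GRing.Zmodule_isLmodule.Build k SRring
  SRscaleA SRscale1 SRscaleDr SRscaleDl.
Fact SRscaleAl (c : k) (a b : SRring) : c *: (a * b) = (c *: a) * b.
Proof. exact: mulrA. Qed.
HB.instance Definition _ := GRing.Lmodule_isLalgebra.Build k SRring SRscaleAl.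
Fact SRscaleAr (c : k) (a b : SRring) : c *: (a * b) = a * (c *: b).
Proof. exact: mulrCA. Qed.
HB.instance Definition _ := GRing.Lalgebra_isAlgebra.Build k SRring SRscaleAr.

Lemma SRpiZ (c : k) p : SRpi (c *: p) = c *: SRpi p.
Proof. by rewrite -mul_mpolyC rmorphM. Qed.

Definition xbar (i : 'I_n) : SRring := SRpi 'X_i.

Definition deg_le (d : nat) (a : SRring) : Prop :=
  exists2 p, SRpi p = a & (msize p <= d.+1)%N.

(* The monomials supported on faces form a basis of k[Delta]; [SRcoef a m] is
   the coordinate of a at such a monomial m, and 0 at the other monomials
   (whose coefficient in a representative of a is not determined by a). *)
Definition SRcoef (a : SRring) (m : 'X_{1..n}) : k :=
  if msupport m \in faces Delta then (repr a : {mpoly k[n]})@_m else 0.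

Lemma SRcoef_pi p m :
  SRcoef (SRpi p) m = if msupport m \in faces Delta then p@_m else 0.
Proof.
rewrite /SRcoef; case: ifP => // mD; apply/eqP.
rewrite -subr_eq0 -mcoeffB; apply/eqP; apply: SRideal_mcoeff mD.
by rewrite Quotient.idealrBE reprK.
Qed.

Definition AutX : groupType := algaut SRring.

Definition AutX_piece (d : nat) (f : AutX) : Prop :=
  forall i, deg_le d (f (xbar i)) /\ deg_le d (aut_inv f (xbar i)).

(* The coordinates of f are those of the tuples (f x_i)_i and (f^-1 x_i)_i on
   the basis of monomials of degree at most d. *)
Definition AutX_filt (d : nat) : affvar k AutX :=
  @AffVar k AutX (AutX_piece d) (bool * 'I_n * 'X_{1..n < d.+1})%type
    (fun j f => let: (b, i, m) := j in
       SRcoef ((if b then f : SRring -> SRring else aut_inv f) (xbar i)) m).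

Definition scale_vars (t : torus k n) (p : {mpoly k[n]}) : {mpoly k[n]} :=
  p \mPo [tuple val (t i) *: 'X_i | i < n].

Lemma scale_vars_ideal t p : p \in SRideal -> scale_vars t p \in SRideal.
Proof.
move=> /asboolP[c ->]; apply/asboolP.
exists (fun s : {set 'I_n} => (\prod_(i in s) val (t i)) *: scale_vars t (c s)).
rewrite /scale_vars raddf_sum; apply: eq_bigr => s _; rewrite /= rmorphM /=.
rewrite -scalerAl scalerAr; congr (_ * _).
rewrite /sqfree_mono rmorph_prod -scaler_prod; apply: eq_bigr => i _ /=.
by rewrite comp_mpolyXU -tnth_nth tnth_mktuple.
Qed.

Definition torus_act (t : torus k n) (a : SRring) : SRring :=
  SRpi (scale_vars t (repr a)).

Lemma torus_act_pi t p : torus_act t (SRpi p) = SRpi (scale_vars t p).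
Proof.
apply/eqP; rewrite -Quotient.idealrBE /scale_vars -rmorphB.
by apply: scale_vars_ideal; rewrite Quotient.idealrBE reprK.
Qed.

Lemma SRpi_surj a : exists p, a = SRpi p.
Proof. by exists (repr a); rewrite /SRpi reprK. Qed.

Fact torus_act_nmod t : GRing.nmod_morphism (torus_act t).
Proof.
split.
  rewrite -[X in torus_act t X](raddf0 (@SRpi)) torus_act_pi. by rewrite /scale_vars comp_mpoly0 raddf0.
move=> a b; have [p ->] := SRpi_surj a; have [q ->] := SRpi_surj b.
by rewrite -rmorphD !torus_act_pi /scale_vars !rmorphD.
Qed.
Fact torus_act_monoid t : GRing.monoid_morphism (torus_act t).
Proof.
split.
  by rewrite -[X in torus_act t X](rmorph1 (@SRpi)) torus_act_pi /scale_vars comp_mpoly1 rmorph1.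
move=> a b; have [p ->] := SRpi_surj a; have [q ->] := SRpi_surj b.
by rewrite -rmorphM !torus_act_pi /scale_vars !rmorphM.
Qed.
Fact torus_act_scalable t : scalable (torus_act t).
Proof.
move=> c a; have [p ->] := SRpi_surj a.
by rewrite -SRpiZ !torus_act_pi /scale_vars comp_mpolyZ SRpiZ.
Qed.
HB.instance Definition _ t :=
  GRing.isNmodMorphism.Build SRring SRring (torus_act t) (torus_act_nmod t).
HB.instance Definition _ t :=
  GRing.isMonoidMorphism.Build SRring SRring (torus_act t) (torus_act_monoid t).
HB.instance Definition _ t :=
  GRing.isScalable.Build k SRring SRring *:%R (torus_act t)
    (torus_act_scalable t).

Lemma torus_act_xbar t i : torus_act t (xbar i) = val (t i) *: xbar i.
Proof.
rewrite torus_act_pi /scale_vars comp_mpolyXU -tnth_nth tnth_mktuple SRpiZ.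
by [].
Qed.

Lemma torus_actM s t a : torus_act s (torus_act t a) = torus_act (s * t)%g a.
Proof.
have [p ->] := SRpi_surj a; rewrite !torus_act_pi; congr SRpi.
elim/mpolyind: p => [|c m p _ _ IH]; first by rewrite /scale_vars !raddf0.
move: IH; rewrite /scale_vars !rmorphD /= => ->; congr (_ + _).
rewrite !comp_mpolyZ; congr (_ *: _).
rewrite !comp_mpolyX rmorph_prod; apply: eq_bigr => i _.
rewrite rmorphXn /= !tnth_mktuple comp_mpolyZ comp_mpolyXU -tnth_nth.
by rewrite tnth_mktuple scalerA ffunE mulrC.
Qed.

Lemma torus_act1 a : torus_act 1%g a = a.
Proof.
have [p ->] := SRpi_surj a; rewrite torus_act_pi /scale_vars; congr SRpi.
rewrite -[RHS]comp_mpoly_id; congr comp_mpoly.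
by apply: eq_mktuple => i; rewrite ffunE scale1r.
Qed.

Fact torus_actK t : cancel (torus_act t) (torus_act t^-1%g).
Proof. by move=> a; rewrite torus_actM mulVg torus_act1. Qed.
Fact torus_actVK t : cancel (torus_act t^-1%g) (torus_act t).
Proof. by move=> a; rewrite torus_actM mulgV torus_act1. Qed.

Definition torus_aut (t : torus k n) : AutX :=
  @AlgAut k SRring (torus_act t : {lrmorphism SRring -> SRring})
    (torus_act t^-1%g : {lrmorphism SRring -> SRring})
    (torus_actK t) (torus_actVK t).

Definition T0 (f : AutX) : Prop := exists t, f = torus_aut t.

End StanleyReisner.

Arguments AutX_filt k {n} Delta d.
Arguments T0 k {n} Delta f.
Arguments torus_aut k {n} Delta t.

(* Main.v *)
From HB Require Import structures.
Require Import Defs.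
From mathcomp Require Import all_boot all_order all_algebra perm.
From mathcomp Require Import generic_quotient ring_quotient mpoly boolp zify.

(** Why the theorem holds. A torus of rank m acting on R = k[Delta] makes R a
    Z^m-graded algebra: the coefficients of h(t) x_i are Laurent polynomials in
    t, and distinct characters are linearly independent, so each x_i is a finite
    sum of weight vectors u_(i,w), on which t acts as the character t^w
    [torus_weight_dec]. The inverse of the parametrization h is regular, and
    this forces the weights that occur to generate Z^m.

    Rank bound [torus_rank_le]. The x_i have linear parts forming the identity
    matrix, so by multilinearity of the determinant some choice of components
    y_i = u_(i,c_i) has an invertible matrix of linear parts [exists_frame]. A
    linear form l on weights gives the Euler derivation E_l, equal to l(w) on
    weight w, and the chain rule reads J (E_l x) = (l(c_i) y_i) with J the
    Jacobian matrix of y. As det J has a nonzero constant term it is not a zero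
    divisor in R. If l kills all c_i, then E_l = 0, hence l kills every weight
    and l = 0. So the c_i span k^m, whence m <= n; this uses characteristic
    zero.

    Dimension [chain_length_le]. A chain of e strict inclusions of irreducible
    closed sets yields, for each N, N^e linearly independent regular functions
    that pull back to Laurent polynomials of exponents O(N); only O(N^m)
    Laurent monomials are available, so e <= m. Thus the dimension is at most
    m <= n, and a torus of dimension n has rank exactly n.

    Conjugacy, for m = n, where the c_i are linearly independent.
    - A fixed point [fix_origin]. Let C be the set of vertices over which Delta
      is a cone. The x_i with i outside C are zero divisors, and generate an
      ideal stable under every automorphism; the quotient is the polynomial
      ring on C. There, by the Euler derivations, weight 0 means constant,
      while a nonzero constant has weight 0. Taking the component of weight 0
      is therefore an algebra morphism to k, that is, a fixed point, and a
      translation along C moves it to the origin.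
    - Weight vectors are monomials [wtvec_monomial]. Once the origin is fixed,
      the order of vanishing there is respected by the torus. The leading part
      of a weight vector is a combination of monomials in y, and independent
      weights leave at most one monomial of a given weight.
    - Matching the relations [frame_faces]. So the y_i generate R, with monomial
      relations. The invertible matrices that express y by x, and x by y, to
      first order provide two permutations of the vertices; each sends
      vanishing squarefree products to vanishing ones, and finiteness of Delta
      turns this into an equivalence. Then x_i |-> y_(p i) is an automorphism;
      it conjugates the torus into the diagonal one, and onto it because the
      c_i generate Z^n [linearize]. *)

Set Implicit Arguments.
Unset Strict Implicit.
Unset Printing Implicit Defensive.

Import GRing.Theory.
Local Open Scope ring_scope.

(** * The Stanley-Reisner ring *)

Section PolynomialEvaluation.
Variables (k : fieldType) (n : nat).

Definition peval (A : comAlgType k) (y : 'I_n -> A) (p : {mpoly k[n]}) : A :=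
  mmap (in_alg A) y p.

Fact peval_is_nmod (A : comAlgType k) (y : 'I_n -> A) :
  GRing.nmod_morphism (peval y).
Proof. by split; [exact: mmap0 | exact: mmapD]. Qed.
Fact peval_is_monoid (A : comAlgType k) (y : 'I_n -> A) :
  GRing.monoid_morphism (peval y).
Proof. by have [] := @mmap_is_multiplicative n k A y (in_alg A). Qed.
Fact peval_is_scalable (A : comAlgType k) (y : 'I_n -> A) : scalable (peval y).
Proof. by move=> c p; rewrite /peval mmapZ /= mulr_algl. Qed.

HB.instance Definition _ (A : comAlgType k) (y : 'I_n -> A) :=
  GRing.isNmodMorphism.Build {mpoly k[n]} A
  (@peval A y) (@peval_is_nmod A y).
HB.instance Definition _ (A : comAlgType k) (y : 'I_n -> A) :=
  GRing.isMonoidMorphism.Build {mpoly k[n]} A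
  (@peval A y) (@peval_is_monoid A y).
HB.instance Definition _ (A : comAlgType k) (y : 'I_n -> A) :=
  GRing.isScalable.Build k {mpoly k[n]} A *:%R
  (@peval A y) (@peval_is_scalable A y).

Lemma pevalXm (A : comAlgType k) (y : 'I_n -> A) m :
  peval y 'X_[m] = \prod_i y i ^+ m i.
Proof. exact: mmapX. Qed.

Lemma pevalX (A : comAlgType k) (y : 'I_n -> A) i : peval y 'X_i = y i.
Proof. by rewrite /peval mmapX mmap1U. Qed.

Lemma pevalC (A : comAlgType k) (y : 'I_n -> A) c : peval y c%:MP = c%:A.
Proof. exact: mmapC. Qed.

Lemma pevalE (A : comAlgType k) (y : 'I_n -> A) p :
  peval y p = \sum_(m <- msupp p) p@_m *: \prod_i y i ^+ m i.
Proof. by apply: eq_bigr => m _; rewrite /= mulr_algl. Qed.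

Lemma lrmorph_peval (A B : comAlgType k) (f : {lrmorphism A -> B})
    (y : 'I_n -> A) p : f (peval y p) = peval (f \o y) p.
Proof.
rewrite !pevalE rmorph_sum; apply: eq_bigr => m _ /=.
by rewrite linearZ rmorph_prod; congr (_ *: _); apply: eq_bigr => i _; rewrite rmorphXn.
Qed.

Lemma peval_id p : peval (fun i => 'X_i) p = p.
Proof.
by rewrite pevalE [RHS]mpolyE; apply: eq_bigr => m _; rewrite mpolyXE_id.
Qed.

Lemma eq_peval (A : comAlgType k) (y z : 'I_n -> A) : y =1 z -> peval y =1 peval z.
Proof. by move=> /funext ->. Qed.

Lemma lrmorph_pevalX (A : comAlgType k) (f : {lrmorphism {mpoly k[n]} -> A}) p :
  f p = peval (fun i => f 'X_i) p.
Proof. by rewrite -[in LHS](peval_id p) lrmorph_peval. Qed.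

End PolynomialEvaluation.

Section StanleyReisnerRing.
Variables (k : fieldType) (n : nat) (Delta : simplicial_complex n).
Local Notation R := (SRring k Delta).
Local Notation Idl := (@SRideal k n Delta).
Local Notation pi := (@SRpi k n Delta).
Local Notation xb := (@xbar k n Delta).

HB.instance Definition _ := GRing.isScalable.Build k {mpoly k[n]} R *:%R pi
  (@SRpiZ k n Delta).

Lemma SRpiE p : pi p = peval xb p.
Proof. exact: (lrmorph_pevalX pi). Qed.

Lemma lrmorph_SRpi (A : comAlgType k) (f : {lrmorphism R -> A}) p :
  f (pi p) = peval (f \o xb) p.
Proof. by rewrite SRpiE lrmorph_peval. Qed.

Lemma eq_lrmorph_SR (A : comAlgType k) (f g : {lrmorphism R -> A}) :
  (forall i, f (xb i) = g (xb i)) -> f =1 g.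
Proof.
move=> fg a; have [p ->] := SRpi_surj a; rewrite !lrmorph_SRpi.
exact: eq_peval.
Qed.

Lemma SRpi_eq0 p : (pi p = 0) <-> (p \in Idl).
Proof.
have -> : (p \in Idl) = (pi p == 0).
  by rewrite -(raddf0 pi) -Quotient.idealrBE subr0.
by split => [->|/eqP].
Qed.

Lemma mem_support (m : 'X_{1..n}) i : (i \in msupport m) = (m i != 0%N).
Proof. by rewrite inE. Qed.

Lemma mono_nonface m : (msupport m \notin faces Delta) -> 'X_[m] \in Idl.
Proof.
move=> mD; apply/asboolP.
exists (fun s => if s == msupport m then 'X_[m - \sum_(i in msupport m) U_(i)]%MM else 0).
rewrite (bigD1 (msupport m)) //= eqxx sqfree_monoE -mpolyXD [X in _ + X]big1 ?addr0.
  congr mpolyX; rewrite submK //; apply/mnm_lepP => i.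
  rewrite mnm_sumE; have [im|im] := boolP (i \in msupport m).
    rewrite (bigD1 i) //= mnm1E eqxx big1 ?addn0 => [|j /andP[_ ji]].
      by rewrite lt0n -mem_support.
    by rewrite mnm1E (negPf ji).
  by rewrite big1 // => j jm; rewrite mnm1E; case: eqP im => // <-; rewrite jm.
by move=> s /andP[_ /negPf ->]; rewrite mul0r.
Qed.

(** Membership in the monomial ideal is tested monomial by monomial; this is what
    makes coefficients at face monomials functions on k[Delta]. *)
Lemma SRidealP p :
  (p \in Idl) <-> (forall m, msupport m \in faces Delta -> p@_m = 0).
Proof.
split=> [pI m|p0]; first exact: (SRideal_mcoeff pI).
rewrite (mpolyE p); apply: (big_ind (fun q => q \in Idl)) => [||m _].
- by rewrite rpred0.
- by move=> u v; apply: rpredD.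
have [mD|mD] := boolP (msupport m \in faces Delta).
  by rewrite p0 // scale0r rpred0.
by rewrite -mul_mpolyC idealMr // mono_nonface.
Qed.

Lemma SRcoef_is_linear m : scalar (fun a : R => SRcoef a m).
Proof.
move=> c a b; have [p ->] := SRpi_surj a; have [q ->] := SRpi_surj b.
rewrite -linearP !SRcoef_pi; case: ifP => _; last by rewrite mulr0 addr0.
by rewrite mcoeffD mcoeffZ.
Qed.

(** A name for [SRcoef] taking the monomial first, so that it can carry the
    structure of a linear form in its second argument. *)
Definition coef (m : 'X_{1..n}) (a : R) : k := SRcoef a m.
HB.instance Definition _ m := GRing.isLinear.Build k R k *%R (coef m)
  (@SRcoef_is_linear m).

Lemma coef_pi p m : coef m (pi p) = if msupport m \in faces Delta then p@_m else 0.
Proof. exact: SRcoef_pi. Qed.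

Lemma SR_eq0P (a : R) : (forall m, coef m a = 0) -> a = 0.
Proof.
have [p ->] := SRpi_surj a => p0; apply/SRpi_eq0/SRidealP => m mD.
by have := p0 m; rewrite coef_pi mD.
Qed.

Lemma msupport0 : msupport 0%MM = set0 :> {set 'I_n}.
Proof. by apply/setP => i; rewrite !inE mnm0E. Qed.

Lemma msupportU (i : 'I_n) : msupport U_(i)%MM = [set i].
Proof. by apply/setP => j; rewrite !inE mnm1E (eq_sym j); case: (i == j). Qed.

Lemma msupportD (m1 m2 : 'X_{1..n}) : msupport (m1 + m2)%MM = msupport m1 :|: msupport m2.
Proof. by apply/setP => j; rewrite !inE mnmDE addn_eq0 negb_and. Qed.

Lemma coef0_mul (a b : R) : coef 0%MM (a * b) = coef 0%MM a * coef 0%MM b.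
Proof.
have [p ->] := SRpi_surj a; have [q ->] := SRpi_surj b.
rewrite -rmorphM !coef_pi msupport0 set0_face.
exact: (rmorphM (mcoeff 0%MM)).
Qed.

Lemma coef0_one : coef 0%MM 1 = 1.
Proof. by rewrite -(rmorph1 pi) coef_pi msupport0 set0_face mcoeff1 eqxx. Qed.

HB.instance Definition _ := GRing.isMonoidMorphism.Build R k (coef 0%MM)
  (conj coef0_one coef0_mul).

(** Linear parts obey the Leibniz rule at the origin: they are well defined on
    k[Delta] because vertices are faces. *)
Lemma coef1_mul (a b : R) i :
  coef U_(i)%MM (a * b) = coef U_(i)%MM a * coef 0%MM b + coef 0%MM a * coef U_(i)%MM b.
Proof.
have [p ->] := SRpi_surj a; have [q ->] := SRpi_surj b.
rewrite -rmorphM !coef_pi msupport0 set0_face msupportU sc_vertex.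
have d (r : {mpoly k[n]}) : r@_U_(i) = (r^`M(i))@_0.
  by rewrite mcoeff_mderiv mnm0E add0m.
by rewrite !d mderivM mcoeffD !rmorphM.
Qed.

Lemma coef_xbar m i : coef m (xb i) = (m == U_(i)%MM)%:R.
Proof.
rewrite coef_pi mcoeffX eq_sym; case: eqP => [->|_]; last by rewrite if_same.
by rewrite msupportU sc_vertex.
Qed.

(** Restriction to the coordinate subspace of a set of vertices. *)
Definition restr (G : {set 'I_n}) : {mpoly k[n]} -> {mpoly k[n]} :=
  peval (fun i => if i \in G then 'X_i else 0).
HB.instance Definition _ G := GRing.LRMorphism.on (restr G).

Lemma restrX G m :
  restr G 'X_[m] = if msupport m \subset G then 'X_[m] else 0.
Proof.
rewrite /restr pevalXm; case: ifP => mG.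
  rewrite mpolyXE_id; apply: eq_bigr => i _; case: ifP => // iG.
  have : i \notin msupport m by apply: contraFN iG; apply/subsetP.
  by rewrite mem_support negbK => /eqP ->; rewrite !expr0.
have /subsetPn[i im iG] := negbT mG.
rewrite (bigD1 i) //= (negPf iG) expr0n.
by move: im; rewrite mem_support => /negPf ->; rewrite mul0r.
Qed.

Lemma mcoeff_restr G p m :
  (restr G p)@_m = if msupport m \subset G then p@_m else 0.
Proof.
elim/mpolyind: p => [|c m' p _ _ IH]; first by rewrite raddf0 mcoeff0 if_same.
rewrite raddfD /= linearZ /= !mcoeffD IH restrX !mcoeffZ mcoeffX.
case: eqP => [->|nm].
  by case: ifP => _; rewrite ?mcoeffX ?eqxx // mcoeff0 mulr0 addr0.
case: (msupport m' \subset G); rewrite ?mcoeffX ?mcoeff0.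
  by case: eqP nm => // _ _; rewrite mulr0 !add0r.
by rewrite mulr0 !add0r.
Qed.

(** The universal property of k[Delta]. *)
Lemma SRlift_subproof (A : comAlgType k) (y : 'I_n -> A) :
  (forall s : {set 'I_n}, s \notin faces Delta -> \prod_(i in s) y i = 0) ->
  exists f : {lrmorphism R -> A}, forall i, f (xb i) = y i.
Proof.
move=> y0; pose f (a : R) := peval y (repr a).
have fpi p : f (pi p) = peval y p.
  apply/eqP; rewrite -subr_eq0 /f -raddfB /=; apply/eqP.
  have /asboolP[c ->] : repr (pi p) - p \in Idl.
    by rewrite Quotient.idealrBE reprK.
  rewrite raddf_sum big1 // => s sD.
  rewrite /= rmorphM /= [X in _ * X]rmorph_prod.
  rewrite (eq_bigr y) => [|i _]; last exact: pevalX.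
  by rewrite y0 // mulr0.
have f_nmod : GRing.nmod_morphism f.
  split; first by rewrite -(raddf0 pi) fpi raddf0.
  move=> a b; have [p ->] := SRpi_surj a; have [q ->] := SRpi_surj b.
  by rewrite -raddfD !fpi raddfD.
have f_mono : GRing.monoid_morphism f.
  split; first by rewrite -(rmorph1 pi) fpi rmorph1.
  move=> a b; have [p ->] := SRpi_surj a; have [q ->] := SRpi_surj b.
  by rewrite -rmorphM !fpi rmorphM.
have f_scal : scalable f.
  move=> c a; have [p ->] := SRpi_surj a.
  by rewrite -SRpiZ !fpi linearZ.
pose F : {lrmorphism R -> A} := HB.pack f
   (GRing.isNmodMorphism.Build R A f f_nmod)
   (GRing.isMonoidMorphism.Build R A f f_mono)
   (GRing.isScalable.Build k R A *:%R f f_scal).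
by exists F => i; rewrite /= fpi pevalX.
Qed.

Lemma prod_xbar (s : {set 'I_n}) : \prod_(i in s) xb i = pi (sqfree_mono k s).
Proof. by rewrite rmorph_prod. Qed.

Lemma msupport_sqfree (s : {set 'I_n}) : msupport (\sum_(i in s) U_(i))%MM = s.
Proof.
apply/setP => i; rewrite mem_support mnm_sumE; have [iS|iS] := boolP (i \in s).
  by rewrite (bigD1 i) //= mnm1E eqxx.
by rewrite big1 // => j jS; rewrite mnm1E; case: eqP iS => // <-; rewrite jS.
Qed.

Lemma prod_xbar_eq0 (s : {set 'I_n}) :
  (\prod_(i in s) xb i == 0) = (s \notin faces Delta).
Proof.
rewrite prod_xbar; have [sD|sD] /= := boolP (s \in faces Delta).
  apply/negP => /eqP /(congr1 (coef (\sum_(i in s) U_(i))%MM)).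
  rewrite coef_pi msupport_sqfree sD sqfree_monoE mcoeffX eqxx raddf0 => /eqP.
  by rewrite oner_eq0.
by apply/eqP/SRpi_eq0; rewrite sqfree_monoE; apply: mono_nonface; rewrite msupport_sqfree.
Qed.

Fact resR_subproof (G : {set 'I_n}) : G \in faces Delta ->
  forall s : {set 'I_n}, s \notin faces Delta ->
  \prod_(i in s) (if i \in G then 'X_i else 0) = 0 :> {mpoly k[n]}.
Proof.
move=> GD s sD; have /subsetPn[i iS iG] : ~~ (s \subset G).
  by apply: contra sD => sG; apply: sc_closed GD.
by rewrite (bigD1 i) //= (negPf iG) mul0r.
Qed.

(** For a face G this is the restriction of functions to a component of the
    arrangement of coordinate subspaces; its target is a domain, and the family of
    all these morphisms is injective on k[Delta] ([resR_neq0]). *)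
Definition resR (G : {set 'I_n}) (GD : G \in faces Delta) :
  {lrmorphism R -> {mpoly k[n]}} := sval (cid (SRlift_subproof (resR_subproof GD))).

Lemma resR_pi G (GD : G \in faces Delta) p : resR GD (pi p) = restr G p.
Proof.
rewrite lrmorph_SRpi; apply: eq_peval => i /=.
by rewrite /resR; case: cid.
Qed.

Lemma mcoeff_resR G (GD : G \in faces Delta) a m :
  (resR GD a)@_m = if msupport m \subset G then coef m a else 0.
Proof.
have [p ->] := SRpi_surj a; rewrite resR_pi mcoeff_restr coef_pi.
by case: ifP => // mG; rewrite (sc_closed mG).
Qed.

Lemma resR_neq0 a : a != 0 -> exists m (mD : msupport m \in faces Delta),
  coef m a != 0 /\ resR mD a != 0.
Proof.
move=> a0; have [m am] : exists m, coef m a != 0.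
  apply: contrapT => H; move/eqP: a0; apply; apply: SR_eq0P => m.
  by apply/eqP; apply: contrapT => /negP am; apply: H; exists m.
have mD : msupport m \in faces Delta.
  by move: am; rewrite /coef /SRcoef; case: ifP => //; rewrite eqxx.
exists m, mD; split=> //; apply: contraNneq am => /(congr1 (mcoeff m)).
by rewrite mcoeff_resR subxx mcoeff0 => ->.
Qed.

Lemma SR_nilp (a : R) N : a ^+ N = 0 -> a = 0.
Proof.
move=> aN; apply/eqP; apply: contraT => /resR_neq0[m [mD [_]]].
have /eqP := congr1 (resR mD) aN; rewrite rmorphXn /= raddf0 expf_eq0.
by move=> /andP[_ ->].
Qed.

(** An element that does not vanish at the origin vanishes on no coordinate
    subspace, since all of them pass through the origin. *)
Lemma SR_nonzerodiv (a b : R) : coef 0%MM a != 0 -> a * b = 0 -> b = 0.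
Proof.
move=> a0 ab; apply/eqP; apply: contraT => /resR_neq0[m [mD [_ bm]]].
have /eqP := congr1 (resR mD) ab; rewrite rmorphM /= raddf0 mulf_eq0 (negPf bm) orbF.
move=> /eqP /(congr1 (mcoeff 0%MM)); rewrite mcoeff_resR msupport0 sub0set mcoeff0.
by move/eqP: a0.
Qed.

End StanleyReisnerRing.

(** * Characters and Laurent polynomials *)

Section Characters.
Variables (k : fieldType) (m : nat).
Local Notation weight := 'rV[int]_m.

Definition chi (w : weight) (t : torus k m) : k := \prod_j val (t j) ^ w 0 j.

Lemma chi0 t : chi 0 t = 1.
Proof. by rewrite /chi big1 // => j _; rewrite mxE expr0z. Qed.

Lemma chiD w w' t : chi (w + w') t = chi w t * chi w' t.
Proof.
rewrite /chi -big_split; apply: eq_bigr => j _ /=.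
by rewrite mxE expfzDr // (valP (t j)).
Qed.

Lemma chi1 w : chi w 1%g = 1.
Proof. by rewrite /chi big1 // => j _; rewrite ffunE exp1rz. Qed.

Lemma chiM w s t : chi w (s * t)%g = chi w s * chi w t.
Proof.
rewrite /chi -big_split; apply: eq_bigr => j _ /=.
by rewrite ffunE /= exprzMl ?unitfE ?(valP (s j)) ?(valP (t j)).
Qed.

Lemma chi_neq0 w t : chi w t != 0.
Proof. by apply/prodf_neq0 => j _; rewrite expfz_neq0 // (valP (t j)). Qed.

Lemma chiV w t : chi w t^-1%g = chi (- w) t.
Proof.
rewrite /chi; apply: eq_bigr => j _.
by rewrite mxE ffunE /= exprz_inv.
Qed.

Lemma chi_delta j t : chi (delta_mx 0 j) t = val (t j).
Proof.
rewrite /chi (bigD1 j) //= big1 => [|i ij]; rewrite mxE.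
  by rewrite mulr1 !eqxx expr1z.
by rewrite (negPf ij) andbF expr0z.
Qed.

Hypothesis char0 : [pchar k] =i pred0.

Lemma natr_eq0F (d : nat) : (d%:R == 0 :> k) = (d == 0%N).
Proof. exact: ((pcharf0P k).1 char0). Qed.

Lemma natr_inj : injective (fun d : nat => d%:R : k).
Proof.
move=> a b; wlog ab : a b / (a <= b)%N => [H e|].
  by case/orP: (leq_total a b) => ab; [|symmetry]; apply: H.
move=> /= e; have : (b - a)%:R == 0 :> k by rewrite natrB // e subrr.
by rewrite natr_eq0F subn_eq0 => ba; apply/eqP; rewrite eqn_leq ab.
Qed.

Lemma intr_eq0F (z : int) : (z%:~R == 0 :> k) = (z == 0).
Proof.
case: z => d; first by rewrite -pmulrn natr_eq0F.
by rewrite NegzE mulrNz oppr_eq0 -pmulrn natr_eq0F.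
Qed.

Lemma exp2z_eq1 (z : int) : (2%:R : k) ^ z = 1 -> z = 0.
Proof.
have H (d : nat) : (2%:R : k) ^+ d = 1 -> d = 0%N.
  rewrite -natrX => /(@natr_inj (2 ^ d)%N 1%N).
  by case: d => // d; rewrite expnS mul2n => /(congr1 odd); rewrite odd_double.
case: z => d; first by move=> /H ->.
by rewrite NegzE -exprnN => /eqP; rewrite invr_eq1 => /eqP /H.
Qed.

(** In characteristic zero 2 has infinite multiplicative order, so points with
    coordinates 1 and 2 separate the characters. *)
Lemma chi_sep w w' : w != w' -> exists t, chi w t != chi w' t.
Proof.
move=> ww'; have /rV0Pn[j] : w - w' != 0 by rewrite subr_eq0.
have two0 : (2%:R : k) != 0 by rewrite natr_eq0F.
pose tj (i : 'I_m) : kstar k := if i == j then exist _ 2%:R two0 else kstar_one k.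
pose t : torus k m := [ffun i => tj i].
move=> wj; exists t; apply: contra_neq wj => e.
have : chi (w - w') t = 1 by rewrite chiD -chiV e chiV -chiD subrr chi0.
rewrite /chi (bigD1 j) //= big1 => [|i ij].
  by rewrite mulr1 ffunE /tj eqxx; apply: exp2z_eq1.
by rewrite ffunE /tj (negPf ij) exp1rz.
Qed.

Section Independence.
Variable V : lmodType k.
Implicit Types (W : seq weight) (v : weight -> V).

(** Artin's argument: translating the relation by a point that separates two
    characters and subtracting gives a shorter relation. *)
Lemma chi_indep W v : uniq W ->
  (forall t, \sum_(w <- W) chi w t *: v w = 0) -> forall w, w \in W -> v w = 0.
Proof.
elim: W v => [|w0 W IH] v //= /andP[w0W uW] sum0.
have vW w : w \in W -> v w = 0.
  move=> wW; have /chi_sep[s sw] : w != w0 by apply: contraNneq w0W => <-.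
  pose v' u := (chi u s - chi w0 s) *: v u.
  have : v' w = 0.
    apply: IH wW => // t; have := sum0 (s * t)%g; have := sum0 t.
    rewrite !big_cons chiM => /(congr1 (fun x => chi w0 s *: x)).
    rewrite scalerDr scalerA scaler0 => e e'.
    have /addrI/eqP := etrans e' (esym e).
    rewrite -subr_eq0 scaler_sumr -sumrB => /eqP sumE; rewrite -[RHS]sumE.
    apply: eq_bigr => u _.
    rewrite /v' chiM !scalerA -scalerBl; congr (_ *: _).
    by rewrite mulrBr ![chi u t * _]mulrC.
  by move/eqP; rewrite scaler_eq0 subr_eq0 (negPf sw) => /eqP.
move=> w; rewrite inE => /orP[/eqP ->|]; last exact: vW.
have := sum0 1%g; rewrite big_cons chi1 scale1r big_seq big1 ?addr0 //.
by move=> u u_W; rewrite vW // scaler0.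
Qed.

(** A list of pairs (w, x) stands for the Laurent polynomial with terms t^w x;
    exponents may repeat, which makes sums and products plain list operations, and
    [lcoef] collects the terms of equal exponent. *)
Definition lcoef (s : seq (weight * V)) (w : weight) : V :=
  \sum_(p <- s | p.1 == w) p.2.
Definition lsupp (s : seq (weight * V)) : seq weight := undup (map fst s).

Lemma lcoef_cons p s w :
  lcoef (p :: s) w = (if p.1 == w then p.2 else 0) + lcoef s w.
Proof. by rewrite /lcoef big_cons; case: ifP => // _; rewrite add0r. Qed.

Lemma lcoef_notin s w : w \notin lsupp s -> lcoef s w = 0.
Proof.
move=> ws; rewrite /lcoef big_seq_cond big1 // => p /andP[ps /eqP pw].
by case/negP: ws; rewrite mem_undup -pw; apply: map_f.
Qed.

Lemma lsum (U : nmodType) (f : weight -> V -> U) (s : seq (weight * V)) W :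
  (forall w, f w 0 = 0) -> (forall w x y, f w (x + y) = f w x + f w y) ->
  uniq W -> (forall p, p \in s -> p.1 \in W) ->
  \sum_(p <- s) f p.1 p.2 = \sum_(w <- W) f w (lcoef s w).
Proof.
move=> f0 fD uW; elim: s => [|p s IH] sW.
  by rewrite big_nil big1 // => w _; rewrite /lcoef big_nil f0.
rewrite big_cons IH => [|q qs]; last by apply: sW; rewrite inE qs orbT.
have pW : p.1 \in W by apply: sW; rewrite inE eqxx.
rewrite (bigD1_seq p.1) //= [in RHS](bigD1_seq p.1) //= lcoef_cons eqxx fD addrA.
congr (_ + _); apply: eq_bigr => w wp.
by rewrite lcoef_cons eq_sym (negPf wp) add0r.
Qed.

Lemma mem_lsupp s p : p \in s -> p.1 \in lsupp s.
Proof. by move=> ps; rewrite mem_undup map_f. Qed.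

Lemma lsum_chi s t :
  \sum_(p <- s) chi p.1 t *: p.2 = \sum_(w <- lsupp s) chi w t *: lcoef s w.
Proof.
apply: (lsum (f := fun w x => chi w t *: x)).
- by move=> u; rewrite scaler0.
- by move=> u x y; rewrite scalerDr.
- exact: undup_uniq.
- exact: mem_lsupp.
Qed.

Lemma lindep s : (forall t, \sum_(p <- s) chi p.1 t *: p.2 = 0) ->
  forall w, lcoef s w = 0.
Proof.
move=> s0 w; have [ws|] := boolP (w \in lsupp s); last exact: lcoef_notin.
by apply: (chi_indep (undup_uniq _) _ ws) => t; rewrite -lsum_chi.
Qed.

(** A Laurent polynomial that vanishes as a function is killed by any operation
    that acts separately on the exponents. *)
Lemma lindep_sum (U : nmodType) (f : weight -> V -> U) s :
  (forall w, f w 0 = 0) -> (forall w x y, f w (x + y) = f w x + f w y) ->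
  (forall t, \sum_(p <- s) chi p.1 t *: p.2 = 0) ->
  \sum_(p <- s) f p.1 p.2 = 0.
Proof.
move=> f0 fD s0; rewrite (lsum f0 fD (undup_uniq (map fst s))).
  by rewrite big1 // => w _; rewrite lindep // f0.
exact: mem_lsupp.
Qed.

(** The predicate on exponents is used twice: with a subgroup of weights, to locate
    the weights of an action, and with a box, to bound degrees. *)
Definition laurent (L : weight -> Prop) (f : torus k m -> V) : Prop :=
  exists2 s : seq (weight * V), (forall p, p \in s -> L p.1) &
    forall t, f t = \sum_(p <- s) chi p.1 t *: p.2.

Lemma laurentS (L L' : weight -> Prop) f :
  (forall w, L w -> L' w) -> laurent L f -> laurent L' f.
Proof. by move=> LL' [s sL fE]; exists s => // p /sL /LL'. Qed.

Lemma laurent_chi (L : weight -> Prop) w (x : V) :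
  L w -> laurent L (fun t => chi w t *: x).
Proof.
move=> Lw; exists [:: (w, x)] => [p|t]; first by rewrite inE => /eqP ->.
by rewrite big_seq1.
Qed.

Lemma laurent_cst (L : weight -> Prop) (x : V) : L 0 -> laurent L (fun=> x).
Proof.
move=> L0; have [s sL sE] := laurent_chi x L0.
by exists s => // t; rewrite -sE chi0 scale1r.
Qed.

Lemma eq_laurent (L : weight -> Prop) f g : f =1 g -> laurent L f -> laurent L g.
Proof. by move=> /funext ->. Qed.

Lemma laurentD L f g : laurent L f -> laurent L g -> laurent L (fun t => f t + g t).
Proof.
move=> [s sL fE] [s' sL' gE]; exists (s ++ s') => [p|t].
  by rewrite mem_cat => /orP[/sL|/sL'].
by rewrite fE gE big_cat.
Qed.

Lemma laurent_sum L (I : Type) (r : seq I) (P : pred I) (F : I -> torus k m -> V) :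
  (forall i, P i -> laurent L (F i)) -> laurent L (fun t => \sum_(i <- r | P i) F i t).
Proof.
move=> LF; elim: r => [|i r IH].
  by exists [::] => // t; rewrite !big_nil.
have [Pi|Pi] := boolP (P i).
  by apply: eq_laurent (laurentD (LF i Pi) IH) => t; rewrite big_cons Pi.
by apply: eq_laurent IH => t; rewrite big_cons (negPf Pi).
Qed.

End Independence.

Lemma laurent_lin (V V' : lmodType k) (h : {linear V -> V'}) L f :
  laurent L f -> laurent L (h \o f).
Proof.
case=> s sL fE; exists [seq (p.1, h p.2) | p <- s].
  by move=> p /mapP[q /sL Lq ->].
move=> t; rewrite big_map /= fE raddf_sum; apply: eq_bigr => p _.
by rewrite /= linearZ.
Qed.

Lemma laurent_scale (V : lmodType k) (x : V) L (f : torus k m -> k) :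
  laurent (V := k^o) L f -> laurent L (fun t => f t *: x).
Proof.
case=> s sL fE; exists [seq (p.1, p.2 *: x) | p <- s].
  by move=> p /mapP[q /sL Lq ->].
move=> t; rewrite big_map /= fE scaler_suml; apply: eq_bigr => p _.
by rewrite /= scalerA.
Qed.

Section LaurentAlgebra.
Variable A : comAlgType k.

Lemma laurentM (L1 L2 L : weight -> Prop) (f g : torus k m -> A) :
  (forall w w', L1 w -> L2 w' -> L (w + w')) ->
  laurent L1 f -> laurent L2 g -> laurent L (fun t => f t * g t).
Proof.
move=> LL [s sL fE] [s' sL' gE].
exists [seq (p.1 + q.1, p.2 * q.2) | p <- s, q <- s'].
  by move=> _ /allpairsP[[p q] /= [/sL Lp /sL' Lq ->]]; apply: LL.
move=> t; rewrite fE gE mulr_suml big_allpairs_dep; apply: eq_bigr => p _.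
rewrite mulr_sumr; apply: eq_bigr => q _ /=.
by rewrite -scalerAl -scalerAr scalerA chiD.
Qed.

Variable L : weight -> Prop.
Hypotheses (L0 : L 0) (LD : forall w w', L w -> L w' -> L (w + w')).

Lemma laurent_prod (I : Type) (r : seq I) (F : I -> torus k m -> A) :
  (forall i, laurent L (F i)) -> laurent L (fun t => \prod_(i <- r) F i t).
Proof.
move=> LF; elim: r => [|i r IH].
  by apply: eq_laurent (laurent_cst 1 L0) => t; rewrite big_nil.
by apply: eq_laurent (laurentM LD (LF i) IH) => t; rewrite big_cons.
Qed.

Lemma laurentX (F : torus k m -> A) d : laurent L F -> laurent L (fun t => F t ^+ d).
Proof.
move=> LF; elim: d => [|d IH]; first by apply: eq_laurent (laurent_cst 1 L0) => t.
by apply: eq_laurent (laurentM LD LF IH) => t; rewrite exprS.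
Qed.

Lemma laurent_peval N (F : 'I_N -> torus k m -> A) (P : {mpoly k[N]}) :
  (forall i, laurent L (F i)) -> laurent L (fun t => peval (fun i => F i t) P).
Proof.
move=> LF; apply: eq_laurent (fun t => esym (pevalE (fun i => F i t) P)) _.
apply: laurent_sum => mm _; have := laurent_prod (index_enum _) (fun i => laurentX (mm i) (LF i)).
exact: (laurent_lin (GRing.scale P@_mm)).
Qed.

End LaurentAlgebra.

Lemma laurent_meval (L : weight -> Prop) N (F : 'I_N -> torus k m -> k) (P : {mpoly k[N]}) :
  L 0 -> (forall w w', L w -> L w' -> L (w + w')) ->
  (forall i, laurent (V := k^o) L (F i)) ->
  laurent (V := k^o) L (fun t => P.@[fun i => F i t]).
Proof.
move=> L0 LD LF; have := laurent_peval (A := k^o) L0 LD P LF.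
apply: eq_laurent => t; rewrite pevalE mevalE; apply: eq_bigr => mm _ //.
Qed.

End Characters.

Section MonomialMaps.
Variables (k : fieldType) (m : nat).
Local Notation weight := 'rV[int]_m.

Lemma chi_sum (I : Type) (r : seq I) (w : I -> weight) t :
  chi (\sum_(i <- r) w i) t = \prod_(i <- r) chi (w i) t :> k.
Proof.
by elim: r => [|i r IH]; rewrite ?big_nil ?chi0 // !big_cons chiD IH.
Qed.

Lemma chiN (w : weight) t : chi (- w) t = (chi w t)^-1 :> k.
Proof.
by apply: (mulfI (chi_neq0 w t)); rewrite -chiD subrr chi0 mulfV ?chi_neq0.
Qed.

Lemma chi_scale (z : int) (w : weight) t : chi (z *: w) t = chi w t ^ z :> k.
Proof.
have H (d : nat) : chi (d%:Z *: w) t = chi w t ^+ d :> k.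
  elim: d => [|d IH]; first by rewrite scale0r chi0.
  by rewrite intS scalerDl scale1r chiD IH exprS.
case: z => d; first exact: H.
by rewrite NegzE scaleNr chiN H -exprnN.
Qed.

Definition monomial_map (Z : 'M[int]_m) (s : torus k m) : torus k m :=
  [ffun j => exist _ (chi (row j Z) s) (chi_neq0 (row j Z) s)].

Lemma chi_monomial_map Z s w : chi w (monomial_map Z s) = chi (w *m Z) s.
Proof.
rewrite mulmx_sum_row chi_sum; apply: eq_bigr => j _.
by rewrite chi_scale ffunE.
Qed.

End MonomialMaps.

(** * Weight vectors and Euler derivations *)

Lemma mpoly_ring_ind (k : fieldType) n (P : {mpoly k[n]} -> Prop) :
  (forall c, P c%:MP) -> (forall i, P 'X_i) ->
  (forall p q, P p -> P q -> P (p + q)) -> (forall p q, P p -> P q -> P (p * q)) ->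
  forall p, P p.
Proof.
move=> PC PX PD PM; elim/mpolyind => [|c m p _ _ Pp].
  by have := PC 0; rewrite mpolyC0.
apply: (PD) => //; rewrite -mul_mpolyC; apply: (PM) => //.
rewrite mpolyXE_id; apply: (big_ind P) => [|x y|i _]; [exact: (PC 1)|exact: PM|].
by elim: (m i) => [|d IH]; [rewrite expr0; apply: (PC 1) | rewrite exprS; apply: (PM)].
Qed.

(** Multilinearity of the determinant in its rows. *)
Lemma det_sum_rows (K : comNzRingType) n (J : finType) (B : 'I_n -> J -> 'I_n -> K) :
  \det (\matrix_(i, j) \sum_a B i a j) =
  \sum_(f : {ffun 'I_n -> J}) \det (\matrix_(i, j) B i (f i) j).
Proof.
rewrite /determinant exchange_big /=; apply: eq_bigr => s _.
rewrite -mulr_sumr; congr (_ * _).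
rewrite (eq_bigr (fun i => \sum_a B i a (s i))) => [|i _]; last by rewrite mxE.
rewrite bigA_distr_bigA; apply: eq_bigr => f _.
by apply: eq_bigr => i _; rewrite mxE.
Qed.

Section Weights.
Variables (k : fieldType) (n : nat) (Delta : simplicial_complex n) (m : nat).
Hypothesis char0 : [pchar k] =i pred0.
Local Notation R := (SRring k Delta).
Local Notation pi := (@SRpi k n Delta).
Local Notation xb := (@xbar k n Delta).
Local Notation weight := 'rV[int]_m.

Definition wtvec (h : torus k m -> AutX k Delta) (w : weight) (a : R) : Prop :=
  forall t, h t a = chi w t *: a.

(** The grading is recorded through the components of the generators x_i: h is a
    family of automorphisms acting on them by characters, a form that is easily
    transported by conjugation. *)
Record weight_dec (h : torus k m -> AutX k Delta) := WeightDec {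
  wd_supp : seq weight;
  wd_comp : 'I_n -> weight -> R;
  wd_uniq : uniq wd_supp;
  wd_mem0 : 0 \in wd_supp;
  wd_out : forall i w, w \notin wd_supp -> wd_comp i w = 0;
  wd_sum : forall i, xb i = \sum_(w <- wd_supp) wd_comp i w;
  wd_homog : forall i w, wtvec h w (wd_comp i w)
}.

(** The subgroup of Z^m generated by the weights that occur is everything; this is
    the trace of faithfulness of the action. *)
Definition spans_weights h (D : weight_dec h) : Prop :=
  forall L : weight -> Prop, L 0 -> (forall w w', L w -> L w' -> L (w + w')) ->
    (forall w, L w -> L (- w)) ->
    (forall i w, wd_comp D i w != 0 -> L w) ->
    forall j, L (delta_mx 0 j).

Section Homogeneous.
Variable h : torus k m -> AutX k Delta.

Lemma wtvec0 w : wtvec h w 0.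
Proof. by move=> t; rewrite raddf0 scaler0. Qed.

Lemma wtvec1 : wtvec h 0 1.
Proof. by move=> t; rewrite rmorph1 chi0 scale1r. Qed.

Lemma wtvecD w a b : wtvec h w a -> wtvec h w b -> wtvec h w (a + b).
Proof. by move=> ha hb t; rewrite raddfD /= ha hb scalerDr. Qed.

Lemma wtvecZ w c a : wtvec h w a -> wtvec h w (c *: a).
Proof. by move=> ha t; rewrite linearZ /= ha !scalerA mulrC. Qed.

Lemma wtvecN w a : wtvec h w a -> wtvec h w (- a).
Proof. by move=> ha; rewrite -scaleN1r; apply: wtvecZ. Qed.

Lemma wtvecM w w' a b : wtvec h w a -> wtvec h w' b -> wtvec h (w + w') (a * b).
Proof.
by move=> ha hb t; rewrite rmorphM /= ha hb -scalerAl -scalerAr scalerA chiD.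
Qed.

Lemma wtvecX w a d : wtvec h w a -> wtvec h (w *+ d) (a ^+ d).
Proof.
move=> ha; elim: d => [|d IH]; first exact: wtvec1.
by rewrite exprS mulrS; apply: wtvecM.
Qed.

Lemma wtvec_prod (I : Type) (r : seq I) (P : pred I) (w : I -> weight) (a : I -> R) :
  (forall i, P i -> wtvec h (w i) (a i)) ->
  wtvec h (\sum_(i <- r | P i) w i) (\prod_(i <- r | P i) a i).
Proof.
move=> H; apply: (big_ind2 (wtvec h)) => //; first exact: wtvec1.
by move=> ? ? ? ?; apply: wtvecM.
Qed.

(** Applying h t to the relation turns it into a relation between characters. *)
Lemma wtvec_indep (U : nmodType) (f : weight -> R -> U) (s : seq (weight * R)) :
  (forall w, f w 0 = 0) -> (forall w x y, f w (x + y) = f w x + f w y) ->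
  (forall p, p \in s -> wtvec h p.1 p.2) ->
  \sum_(p <- s) p.2 = 0 -> \sum_(p <- s) f p.1 p.2 = 0.
Proof.
move=> f0 fD sh s0; apply: lindep_sum => // t.
have := congr1 (h t) s0; rewrite raddf0 raddf_sum /= => sE; rewrite -[RHS]sE.
by rewrite !big_seq; apply: eq_bigr => p /sh ->.
Qed.

(** The graph of the map that sends a to the sum of the f w (a_w), where a_w is the
    component of a of weight w. Working with the graph spares a normal form for
    decompositions: [wsum_fun] says that the graph is functional, and it is closed
    under sums because lists can be concatenated. *)
Definition wsum (U : nmodType) (f : weight -> R -> U) (a : R) (c : U) : Prop :=
  exists2 s : seq (weight * R), (forall p, p \in s -> wtvec h p.1 p.2) &
    a = \sum_(p <- s) p.2 /\ c = \sum_(p <- s) f p.1 p.2.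

Lemma wsum_homog (U : nmodType) (f : weight -> R -> U) w a :
  wtvec h w a -> wsum f a (f w a).
Proof.
move=> ha; exists [:: (w, a)]; last by rewrite !big_seq1.
by move=> p; rewrite inE => /eqP ->.
Qed.

Section WSum.
Variables (U : zmodType) (f : weight -> R -> U).
Hypotheses (f0 : forall w, f w 0 = 0).
Hypotheses (fD : forall w x y, f w (x + y) = f w x + f w y).

Lemma wsum_fun a c c' : wsum f a c -> wsum f a c' -> c = c'.
Proof.
move=> [s sh [aE ->]] [s' sh' [aE' ->]].
have fN w x : f w (- x) = - f w x.
  by apply/eqP; rewrite -addr_eq0 -fD addNr f0.
pose r := s ++ [seq (p.1, - p.2) | p <- s'].
have rh p : p \in r -> wtvec h p.1 p.2.
  rewrite mem_cat => /orP[/sh //|/mapP[q /sh' hq ->] /=].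
  exact: wtvecN.
have := wtvec_indep f0 fD rh; rewrite !big_cat !big_map /= sumrN -aE -aE' subrr.
move=> /(_ erefl); under [X in _ + X]eq_bigr => p _ do rewrite fN.
by rewrite sumrN => /eqP; rewrite subr_eq0 => /eqP.
Qed.

Lemma wsumD a b c d : wsum f a c -> wsum f b d -> wsum f (a + b) (c + d).
Proof.
move=> [s sh [-> ->]] [s' sh' [-> ->]]; exists (s ++ s'); last by rewrite !big_cat.
by move=> p; rewrite mem_cat => /orP[/sh|/sh'].
Qed.

Lemma wsum_comp (D : weight_dec h) i :
  wsum f (xb i) (\sum_(w <- wd_supp D) f w (wd_comp D i w)).
Proof.
exists [seq (w, wd_comp D i w) | w <- wd_supp D].
  by move=> p /mapP[w _ ->]; apply: wd_homog.
by rewrite !big_map -wd_sum.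
Qed.

End WSum.

Lemma wtvec_sum0 (W : seq weight) (v : weight -> R) : uniq W ->
  (forall w, wtvec h w (v w)) -> \sum_(w <- W) v w = 0 ->
  forall w, w \in W -> v w = 0.
Proof.
move=> uW hv s0; apply: chi_indep => // t.
have := congr1 (h t) s0; rewrite raddf0 raddf_sum /= => sE; rewrite -[RHS]sE.
by apply: eq_bigr => w _; rewrite hv.
Qed.

Section Euler.
Variable D : weight_dec h.
Variable l : 'cV[k]_m.

Definition wtk (w : weight) : 'rV[k]_m := map_mx intr w.
Definition ev (w : weight) : k := (wtk w *m l) 0 0.

Lemma wtk0 : wtk 0 = 0.
Proof. by apply/matrixP => i j; rewrite !mxE. Qed.
Lemma wtkD w w' : wtk (w + w') = wtk w + wtk w'.
Proof. by apply/matrixP => i j; rewrite !mxE rmorphD. Qed.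
Lemma ev0 : ev 0 = 0.
Proof. by rewrite /ev wtk0 mul0mx mxE. Qed.
Lemma evD w w' : ev (w + w') = ev w + ev w'.
Proof. by rewrite /ev wtkD mulmxDl mxE. Qed.
Lemma evN w : ev (- w) = - ev w.
Proof. by apply/eqP; rewrite -addr_eq0 -evD addNr ev0. Qed.

(** The value at x_i of the Euler derivation attached to l, which multiplies
    weight vectors of weight w by l(w). *)
Definition efield (i : 'I_n) : R := \sum_(w <- wd_supp D) ev w *: wd_comp D i w.

(** The chain rule for the Euler derivation, by induction on a polynomial
    representative. *)
Lemma euler_wsum p :
  wsum (fun w a => ev w *: a) (pi p) (\sum_i pi p^`M(i) * efield i).
Proof.
elim/mpoly_ring_ind: p => [c|i|p q IHp IHq|p q IHp IHq].
- rewrite big1 => [|i _]; last by rewrite mderivC raddf0 mul0r.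
  rewrite -[0](scale0r (pi c%:MP)) -ev0; apply: wsum_homog.
  have -> : pi c%:MP = c *: 1 by rewrite -(rmorph1 pi) -SRpiZ -alg_mpolyC.
  by apply: wtvecZ; apply: wtvec1.
- rewrite (bigD1 i) //= big1 => [|j ji].
    rewrite addr0 mderivX mnm1E eqxx scale1r -[X in 'X_[X - _]]add0m addmK mpolyX0.
    by rewrite rmorph1 mul1r; apply: wsum_comp.
  by rewrite mderivX mnm1E eq_sym (negPf ji) scale0r raddf0 mul0r.
- rewrite raddfD (eq_bigr (fun i => pi p^`M(i) * efield i + pi q^`M(i) * efield i)).
    by rewrite big_split; apply: wsumD.
  by move=> i _; rewrite mderivD raddfD mulrDl.
have [s sh [pE dpE]] := IHp; have [s' sh' [qE dqE]] := IHq.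
exists [seq (a.1 + b.1, a.2 * b.2) | a <- s, b <- s'].
  by move=> _ /allpairsP[[a b] /= [/sh ha /sh' hb ->]]; apply: wtvecM.
split.
  rewrite rmorphM /= pE qE mulr_suml big_allpairs_dep; apply: eq_bigr => a _.
  by rewrite mulr_sumr.
transitivity (pi q * (\sum_i pi p^`M(i) * efield i) +
              pi p * (\sum_i pi q^`M(i) * efield i)).
  rewrite !mulr_sumr -big_split; apply: eq_bigr => i _ /=.
  by rewrite mderivM raddfD /= !rmorphM /= mulrDl; congr (_ + _); rewrite !mulrA // [pi q * _]mulrC.
rewrite dpE dqE pE qE big_allpairs_dep mulrC !mulr_suml -big_split.
apply: eq_bigr => a _ /=; rewrite !mulr_sumr -big_split; apply: eq_bigr => b _ /=.
by rewrite evD scalerDl scalerAl scalerAr.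
Qed.

Lemma euler_homog w p : wtvec h w (pi p) ->
  \sum_i pi p^`M(i) * efield i = ev w *: pi p.
Proof.
move=> hp; apply: wsum_fun (euler_wsum p) (wsum_homog _ hp).
- by move=> u; rewrite scaler0.
- by move=> u x y; rewrite scalerDr.
Qed.

Lemma efield_eq0_ev : (forall i, efield i = 0) ->
  forall i w, wd_comp D i w != 0 -> ev w = 0.
Proof.
move=> e0 i w uw; have wW : w \in wd_supp D.
  by apply: contraNT uw => /wd_out ->.
have := wtvec_sum0 (wd_uniq D) (fun u => wtvecZ (ev u) (wd_homog D i u)) (e0 i) wW.
by move/eqP; rewrite scaler_eq0 (negPf uw) orbF => /eqP.
Qed.

End Euler.
End Homogeneous.
End Weights.

(** * The rank of a torus *)

Section Rank.
Variables (k : fieldType) (n : nat) (Delta : simplicial_complex n) (m : nat).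
Hypothesis char0 : [pchar k] =i pred0.
Local Notation R := (SRring k Delta).
Local Notation pi := (@SRpi k n Delta).
Local Notation xb := (@xbar k n Delta).
Local Notation weight := 'rV[int]_m.

(** The differential at the origin of the map with components y. *)
Definition linpart (y : 'I_n -> R) : 'M[k]_n := \matrix_(i, j) coef U_(j)%MM (y i).

Lemma mderiv_coef0 (p : {mpoly k[n]}) i : (p^`M(i))@_0%MM = coef U_(i)%MM (pi p).
Proof.
by rewrite coef_pi msupportU sc_vertex mcoeff_mderiv mnm0E add0m mulr1n.
Qed.

Variables (h : torus k m -> AutX k Delta) (D : weight_dec h).

(** The x_i themselves have the identity as matrix of linear parts; expanding its
    determinant along the weight decompositions gives a sum of determinants equal
    to 1, so one of them is nonzero. *)
Lemma exists_frame : exists c : 'I_n -> weight,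
  \det (linpart (fun i => wd_comp D i (c i))) != 0.
Proof.
set W := wd_supp D; pose J := 'I_(size W); pose wt (a : J) := nth 0 W a.
pose B i a j := coef U_(j)%MM (wd_comp D i (wt a)).
have : \det (\matrix_(i, j) \sum_a B i a j) = 1.
  rewrite -[RHS](det1 k n); congr (\det _).
  apply/matrixP => i j; rewrite !mxE.
  rewrite -raddf_sum /=; have -> : \sum_a wd_comp D i (wt a) = xb i.
    by rewrite (wd_sum D) (big_nth 0) big_mkord.
  by rewrite coef_xbar eq_mnm1 eq_sym.
rewrite det_sum_rows => sum1.
have [f Hf] : exists f : {ffun 'I_n -> J}, \det (\matrix_(i, j) B i (f i) j) != 0.
  apply: contrapT => H; move/eqP: sum1; rewrite big1 ?(eq_sym 0) ?oner_eq0 // => f _.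
  by apply/eqP; apply: contrapT => /negP Hf; apply: H; exists f.
exists (fun i => wt (f i)); apply: contraNneq Hf => <-; apply/eqP.
by congr (\det _); apply/matrixP => i j; rewrite !mxE.
Qed.

Section Jacobian.
Variable y : 'I_n -> R.

(** The entries depend on the representatives chosen in the quotient; the chain rule
    and the value at the origin do not. *)
Definition jac : 'M[R]_n := \matrix_(i, j) pi ((repr (y i) : {mpoly k[n]})^`M(j)).

Lemma pi_repr (a : R) : pi (repr a) = a.
Proof. by rewrite /SRpi reprK. Qed.

Lemma coef0_jac : map_mx (coef 0%MM) jac = linpart y.
Proof.
apply/matrixP => i j; rewrite !mxE coef_pi msupport0 set0_face.
by rewrite mderiv_coef0 pi_repr.
Qed.

Lemma jac_euler (c : 'I_n -> weight) l : (forall i, wtvec h (c i) (y i)) ->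
  jac *m (\col_i efield D l i) = \col_i (ev l (c i) *: y i).
Proof.
move=> yc; apply/matrixP => i j; rewrite !mxE ord1.
have yw : wtvec h (c i) (pi (repr (y i))) by rewrite pi_repr.
rewrite -[X in _ = _ *: X]pi_repr -(euler_homog char0 D l yw).
by apply: eq_bigr => a _; rewrite !mxE.
Qed.

(** Cramer's rule: the determinant is not a zero divisor because its value at the
    origin is nonzero. *)
Lemma jac_reg (v : 'cV[R]_n) : \det (linpart y) != 0 -> jac *m v = 0 -> v = 0.
Proof.
move=> dy jv; have : \adj jac *m (jac *m v) = 0 by rewrite jv mulmx0.
rewrite mulmxA mul_adj_mx mul_scalar_mx => /matrixP dv.
apply/matrixP => i j; have := dv i j; rewrite !mxE.
apply: SR_nonzerodiv; by rewrite -det_map_mx coef0_jac.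
Qed.

End Jacobian.

Definition wtmx (c : 'I_n -> weight) : 'M[k]_(n, m) := \matrix_i wtk k (c i).

Lemma wtmx_ev c l i : (wtmx c *m l) i 0 = ev l (c i).
Proof. by rewrite /ev !mxE; apply: eq_bigr => j _; rewrite !mxE. Qed.

(** A linear form vanishing on the weights of the frame has Euler derivation zero,
    so it vanishes on all weights; these generate Z^m. *)
Lemma wtmx_inj (y : 'I_n -> R) (c : 'I_n -> weight) :
  spans_weights D ->
  (forall i, wtvec h (c i) (y i)) -> \det (linpart y) != 0 ->
  forall l : 'cV[k]_m, wtmx c *m l = 0 -> l = 0.
Proof.
move=> sD yc dy l cl.
have e0 i : efield D l i = 0.
  have : \col_i efield D l i = 0.
    apply: jac_reg dy _; rewrite (jac_euler _ yc).
    by apply/matrixP => a b; rewrite !mxE -wtmx_ev cl mxE scale0r.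
  by move/matrixP/(_ i 0); rewrite !mxE.
have ev0w := efield_eq0_ev char0 e0.
apply/matrixP => j a; rewrite ord1 mxE.
have := sD (fun w => ev l w = 0) (ev0 l) _ _ ev0w j.
rewrite /ev => H; rewrite -{}H ?mxE.
- rewrite (bigD1 j) //= !mxE !eqxx mul1r big1 ?addr0 // => i ij.
  by rewrite !mxE (negPf ij) andbF mul0r.
- by move=> w w' ww ww'; rewrite -/(ev l _) evD /ev ww ww' addr0.
- by move=> w ww; rewrite -/(ev l _) evN /ev ww oppr0.
Qed.

Theorem torus_rank_le : spans_weights D -> (m <= n)%N.
Proof.
move=> sD; have [c dc] := exists_frame.
have inj := wtmx_inj sD (fun i => wd_homog D i (c i)) dc.
have /eqP <- : row_free (wtmx c)^T; last exact: rank_leq_col.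
apply: inj_row_free => v vc; apply: trmx_inj; rewrite trmx0; apply: inj.
by apply: trmx_inj; rewrite trmx_mul trmxK trmx0.
Qed.

End Rank.

Lemma wtmx_unit (k : fieldType) n (Delta : simplicial_complex n)
    (char0 : [pchar k] =i pred0) (h : torus k n -> AutX k Delta) (D : weight_dec h)
    (y : 'I_n -> SRring k Delta) (c : 'I_n -> 'rV[int]_n) :
  spans_weights D -> (forall i, wtvec h (c i) (y i)) -> \det (linpart y) != 0 ->
  wtmx k c \in unitmx.
Proof.
move=> sD yc dy; have inj := wtmx_inj char0 sD yc dy.
rewrite -unitmx_tr -row_free_unit; apply: inj_row_free => v vc.
apply: trmx_inj; rewrite trmx0; apply: inj.
by apply: trmx_inj; rewrite trmx_mul trmxK trmx0.
Qed.

(** * A fixed point in the intersection of the components *)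

(** Some term of the Leibniz expansion is nonzero. *)
Lemma det_neq0_perm (K : comNzRingType) n (A : 'M[K]_n) :
  \det A != 0 -> exists s : 'S_n, forall i, A i (s i) != 0.
Proof.
move=> dA; apply: contrapT => H; move/eqP: dA; apply.
rewrite /determinant big1 // => s _.
have [a /eqP a0] : exists a, A a (s a) == 0.
  apply: contrapT => H'; apply: H; exists s => a.
  by apply/negP => a0; apply: H'; exists a.
by rewrite (bigD1 a) //= a0 mul0r mulr0.
Qed.

Section Cone.
Variables (k : fieldType) (n : nat) (Delta : simplicial_complex n).
Local Notation R := (SRring k Delta).
Local Notation pi := (@SRpi k n Delta).
Local Notation xb := (@xbar k n Delta).

(** The vertices over which Delta is a cone, i.e. the intersection of all facets. *)
Definition cone_set : {set 'I_n} :=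
  [set i | [forall F : {set 'I_n}, (F \in faces Delta) ==> (i |: F \in faces Delta)]].
Local Notation C := cone_set.

Lemma cone_face F : F \in faces Delta -> F :|: C \in faces Delta.
Proof.
move=> FD; have H (s : seq 'I_n) : {subset s <= C} -> F :|: [set x in s] \in faces Delta.
  elim: s => [|i s IH] sC; first by rewrite set_nil setU0.
  rewrite set_cons setUCA; have /sC : i \in i :: s by rewrite inE eqxx.
  rewrite inE => /forallP/(_ (F :|: [set x in s]))/implyP; apply; apply: IH => x xs.
  by apply: sC; rewrite inE xs orbT.
have := H (enum C); rewrite set_enum; apply => x; by rewrite mem_enum.
Qed.

Lemma coneP : C \in faces Delta.
Proof. by rewrite -(set0U C); apply/cone_face/set0_face. Qed.

(** Restriction to the intersection of all irreducible components. *)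
Definition resC : {lrmorphism R -> {mpoly k[n]}} := resR k coneP.

Lemma mcoeff_resC a M : (resC a)@_M = if msupport M \subset C then coef M a else 0.
Proof. exact: mcoeff_resR. Qed.

Lemma resC_xbar i : resC (xb i) = if i \in C then 'X_i else 0.
Proof. by rewrite resR_pi /restr pevalX. Qed.

(** A vertex i outside the cone set admits a face F with F + i not a face, so x_i is a
    zero divisor, and so is its image under f. A zero divisor vanishes on some
    coordinate subspace that contains the one of the cone set. *)
Lemma resC_aut (f : AutX k Delta) i : i \notin C -> resC (f (xb i)) = 0.
Proof.
rewrite inE negb_forall => /existsP[F]; rewrite negb_imply => /andP[FD iFD].
have iF : i \notin F by apply: contra iFD => iF; rewrite setUC (setUidPl _) ?sub1set.
have xF0 : \prod_(j in F) xb j != 0 by rewrite prod_xbar_eq0 negbK.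
have fF0 : f (\prod_(j in F) xb j) != 0.
  by apply: contraNneq xF0 => /(congr1 (aut_inv f)); rewrite aut_funK raddf0 => ->.
have := congr1 f (eqP (etrans (prod_xbar_eq0 k Delta (i |: F)) iFD)).
rewrite big_setU1 //= rmorphM raddf0.
have [M [MD [fM _]]] := resR_neq0 fF0.
have GD := cone_face MD.
move=> /(congr1 (resR k GD)); rewrite rmorphM raddf0 /= => /eqP; rewrite mulf_eq0.
have /negPf -> : resR k GD (f (\prod_(j in F) xb j)) != 0.
  apply: contraNneq fM => /(congr1 (mcoeff M)).
  by rewrite mcoeff_resR subsetUl mcoeff0 => ->.
rewrite orbF => /eqP fi0; apply/mpolyP => N; rewrite mcoeff_resC mcoeff0.
case: ifP => // NC; move/(congr1 (mcoeff N)): fi0.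
by rewrite mcoeff_resR mcoeff0 (subset_trans NC) // subsetUr.
Qed.

Lemma mderiv_resC (p : {mpoly k[n]}) i : i \in C ->
  resC (pi p^`M(i)) = (resC (pi p))^`M(i).
Proof.
move=> iC; apply/mpolyP => M; rewrite mcoeff_mderiv !mcoeff_resC msupportD msupportU.
rewrite subUset sub1set iC andbT.
case: ifP => MC; last by rewrite mul0rn.
rewrite !coef_pi (sc_closed MC coneP) mcoeff_mderiv msupportD msupportU.
by rewrite (@sc_closed _ Delta C) ?coneP // subUset MC sub1set.
Qed.

End Cone.

Lemma meval_peval (k : fieldType) n N (z : 'I_n -> {mpoly k[N]}) v p :
  (peval z p).@[v] = p.@[fun i => (z i).@[v]].
Proof.
rewrite pevalE [RHS]mevalE (raddf_sum (meval v)); apply: eq_bigr => M _ /=.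
rewrite mevalZ (rmorph_prod (meval v)); congr (_ * _).
by apply: eq_bigr => i _; rewrite rmorphXn.
Qed.

Lemma coef0_peval (k : fieldType) n (Delta : simplicial_complex n)
    (z : 'I_n -> SRring k Delta) p :
  coef 0%MM (peval z p) = p.@[fun i => coef 0%MM (z i)].
Proof.
rewrite pevalE mevalE raddf_sum; apply: eq_bigr => M _ /=.
by rewrite linearZ rmorph_prod; congr (_ * _); apply: eq_bigr => i _; rewrite rmorphXn.
Qed.

Lemma wtk_inj (k : fieldType) m (char0 : [pchar k] =i pred0) (w : 'rV[int]_m) :
  wtk k w = 0 -> w = 0.
Proof.
move=> /matrixP w0; apply/matrixP => i j; have /eqP := w0 i j.
by rewrite !mxE intr_eq0F // => /eqP.
Qed.

Section FixedPoint.
Variables (k : fieldType) (n : nat) (Delta : simplicial_complex n).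
Hypothesis char0 : [pchar k] =i pred0.
Local Notation R := (SRring k Delta).
Local Notation pi := (@SRpi k n Delta).
Local Notation xb := (@xbar k n Delta).
Local Notation weight := 'rV[int]_n.
Local Notation C := (cone_set Delta).
Local Notation rC := (@resC k n Delta).

Variables (h : torus k n -> AutX k Delta) (D : weight_dec h).
Hypothesis sD : spans_weights D.

(** The previous vanishing holds for all t, hence component by component. *)
Lemma resC_comp i w : i \notin C -> rC (wd_comp D i w) = 0.
Proof.
move=> iC; have [wW|/wd_out ->] := boolP (w \in wd_supp D); last by rewrite raddf0.
apply: (chi_indep char0 (v := fun w => rC (wd_comp D i w)) (wd_uniq D) _ wW) => t.
rewrite -[RHS](resC_aut (h t) iC) (wd_sum D) !raddf_sum.
by apply: eq_bigr => u _ /=; rewrite (wd_homog D) linearZ.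
Qed.

Lemma resC_efield l i : i \notin C -> rC (efield D l i) = 0.
Proof.
move=> iC; rewrite raddf_sum big1 //= => w _.
by rewrite linearZ /= resC_comp // scaler0.
Qed.

Variable c : 'I_n -> weight.
Local Notation y := (fun i => wd_comp D i (c i)).
Hypothesis dc : \det (linpart y) != 0.

Let wtmxU : wtmx k c \in unitmx.
Proof. exact: (wtmx_unit char0 sD (fun i => wd_homog D i (c i)) dc). Qed.

(* [dual j] is the linear form that takes the value 1 on c_j and 0 on the others. *)
Local Notation dual j := (col j (invmx (wtmx k c))).

Lemma ev_dual i j : ev (dual j) (c i) = (i == j)%:R.
Proof. by rewrite -wtmx_ev colE mulmxA -colE mulmxV ?wtmxU // !mxE. Qed.

Lemma ev_dual_eq0 w : (forall j, ev (dual j) w = 0) -> w = 0.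
Proof.
move=> w0; apply: (wtk_inj char0); suff : wtk k w *m invmx (wtmx k c) = 0.
  by move/(congr1 (mulmx^~ (wtmx k c))); rewrite mulmxKV ?wtmxU // mul0mx.
apply/matrixP => i j; rewrite ord1 [RHS]mxE -(w0 j) /ev colE mulmxA -colE.
by rewrite [RHS]mxE.
Qed.

(** Frame members outside C vanish on the coordinate subspace of C, so the matrix of
    linear parts is block triangular and its block on C is invertible. *)
Lemma resC_frame_neq0 i : i \in C -> rC (y i) != 0.
Proof.
move=> iC; have [s s0] := det_neq0_perm dc.
have s0C a b : rC (y a) = 0 -> b \in C -> linpart y a b = 0.
  move=> /(congr1 (mcoeff U_(b)%MM)) + bC; rewrite mcoeff_resC msupportU sub1set bC.
  by rewrite mcoeff0 mxE.
have sC : [set s x | x in ~: C] = ~: C.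
  apply/eqP; rewrite eqEcard card_imset ?leqnn ?andbT; last exact: perm_inj.
  apply/subsetP => _ /imsetP[a aC ->]; rewrite inE in aC; rewrite inE.
  apply: contraNN (s0 a) => /(s0C a) ->; by rewrite ?eqxx // resC_comp.
apply: contraNneq (s0 i) => /s0C -> //; move: iC; apply: contraLR.
rewrite -!in_setC -{1}sC => /imsetP[a aC /perm_inj ->] //.
Qed.

(* The values at the x_i, i in C, of the Euler derivations dual to the frame, and
   the Jacobian matrix of the frame along C. Both are completed by an identity
   block outside C to keep the index set of all vertices. *)
Let E : 'M[{mpoly k[n]}]_n :=
  \matrix_(i, j) if i \in C then rC (efield D (dual j) i) else (i == j)%:R.
Let J : 'M[{mpoly k[n]}]_n :=
  \matrix_(i, j) if (i \in C) && (j \in C) then rC (jac y i j) else (i == j)%:R.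

Lemma JE : J *m E = diag_mx (\row_i if i \in C then rC (y i) else 1).
Proof.
apply/matrixP => i j; rewrite !mxE; have [iC|iC] := boolP (i \in C); last first.
  rewrite (bigD1 i) //= !mxE (negPf iC) eqxx mul1r big1 ?addr0 // => l li.
  by rewrite !mxE (negPf iC) eq_sym (negPf li) mul0r.
have := jac_euler char0 D (dual j) (fun i => wd_homog D i (c i)).
move=> /matrixP/(_ i 0); rewrite !mxE ev_dual => /(congr1 rC).
rewrite linearZ raddf_sum /= scaler_nat => <-; apply: eq_bigr => l _.
rewrite !mxE iC /= rmorphM /=; case: ifP => // /negbT lC.
rewrite resC_efield // mulr0; case: eqP => [il|]; last by rewrite mul0r.
by rewrite -il iC in lC.
Qed.

(** The product J * E is diagonal with nonzero entries, over a domain. *)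
Lemma E_inj (v : 'rV[{mpoly k[n]}]_n) : v *m E = 0 -> v = 0.
Proof.
have dE : \det E != 0.
  have : \det (J *m E) != 0.
    rewrite JE det_diag; apply/prodf_neq0 => i _; rewrite mxE.
    by case: ifP => [/resC_frame_neq0 //|_]; rewrite oner_eq0.
  by rewrite det_mulmx mulf_eq0 negb_or => /andP[].
move=> vE; have : v *m E *m \adj E = 0 by rewrite vE mul0mx.
rewrite -mulmxA mul_mx_adj mul_mx_scalar => /matrixP dv.
apply/matrixP => i j; have /eqP := dv i j.
by rewrite !mxE mulf_eq0 (negPf dE) => /eqP.
Qed.

Lemma resC_euler w a j : wtvec h w a ->
  \sum_(i in C) (rC a)^`M(i) * rC (efield D (dual j) i) = ev (dual j) w *: rC a.
Proof.
move=> aw; have aw' : wtvec h w (pi (repr a)) by rewrite pi_repr.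
have := euler_homog char0 D (dual j) aw'; rewrite pi_repr => /(congr1 rC).
rewrite linearZ raddf_sum /= => <-; rewrite [RHS](bigID (mem C)) /= [X in _ + X]big1 ?addr0.
  apply: eq_bigr => i iC; rewrite rmorphM /= (mderiv_resC _ iC) pi_repr //.
by move=> i iC; rewrite rmorphM /= resC_efield // mulr0.
Qed.

(** All Euler derivations kill an element of weight 0; by [E_inj] so do all partial
    derivatives along C, and characteristic zero makes it constant. *)
Lemma resC_wt0 a : wtvec h 0 a -> rC a = (coef 0%MM a)%:MP.
Proof.
move=> a0; pose v : 'rV_n := \row_i if i \in C then (rC a)^`M(i) else 0.
have /matrixP v0 : v = 0.
  apply: E_inj; apply/matrixP => i j; rewrite ord1 !mxE.
  rewrite (bigID (mem C)) /= [X in _ + X]big1 => [|l lC].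
    rewrite addr0 -[RHS](scale0r (rC a)) -(ev0 (dual j)) -(resC_euler j a0).
    by apply: eq_bigr => l lC; rewrite !mxE lC.
  by rewrite !mxE (negPf lC) mul0r.
apply/mpolyP => M; rewrite mcoeffC.
have [->|M0] := eqVneq M 0%MM; first by rewrite mcoeff_resC msupport0 sub0set mulr1.
rewrite mulr0; have [/subsetP MC|MC] := boolP (msupport M \subset C); last first.
  by rewrite mcoeff_resC (negPf MC).
have [i iM] : exists i, i \in msupport M.
  apply/set0Pn; apply: contraNneq M0 => /setP e; apply/eqP/mnmP => i.
  by have := e i; rewrite !inE mnm0E => /negbFE/eqP.
have := v0 0 i; rewrite !mxE (MC _ iM) => /(congr1 (mcoeff (M - U_(i))%MM)) /eqP.
rewrite mcoeff_mderiv submK ?lep1mP -?mem_support // mcoeff0.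
by rewrite -mulr_natr mulf_eq0 natr_eq0F // orbF => /eqP.
Qed.

(** The Euler derivations kill constants, but some of them multiplies an element of
    nonzero weight by a nonzero scalar. *)
Lemma resC_wt_neq0 w a : w != 0 -> wtvec h w a -> (msize (rC a) <= 1)%N -> rC a = 0.
Proof.
move=> w0 aw /msize1_polyC ac; apply: contraNeq w0 => a0; apply/eqP.
apply: ev_dual_eq0 => j; apply/eqP; have := resC_euler j aw.
rewrite big1 => [/esym/eqP|i _]; last by rewrite ac mderivC mul0r.
by rewrite scaler_eq0 (negPf a0) orbF.
Qed.

(** The coordinates of the fixed point are the components of weight 0 of the
    coordinate functions, which are constants on the subspace of C. *)
Definition fixpt (i : 'I_n) : k := coef 0%MM (wd_comp D i 0).

Lemma fixpt_out i : i \notin C -> fixpt i = 0.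
Proof.
move=> /(resC_comp 0)/(congr1 (mcoeff 0%MM)).
by rewrite mcoeff_resC msupport0 sub0set mcoeff0.
Qed.

Let f (w : weight) (a : R) : k := if w == 0 then coef 0%MM a else 0.

(** Taking the component of weight 0 is multiplicative on the polynomial ring of C: if
    u and v have opposite nonzero weights, then u v is constant, and were it nonzero
    u and v would be constants too, contradicting [resC_wt_neq0]. *)
Lemma fixpt_wsum a : wsum h f a (rC a).@[fixpt].
Proof.
have [p ->] := SRpi_surj a; elim/mpoly_ring_ind: p => [d|i|p q IHp IHq|p q IHp IHq].
- have -> : pi d%:MP = d *: 1 by rewrite -(rmorph1 pi) -SRpiZ -alg_mpolyC.
  have -> : (rC (d *: 1)).@[fixpt] = f 0 (d *: 1).
    rewrite /f eqxx linearZ rmorph1 mevalZ meval1 [RHS]linearZ.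
    by rewrite [X in _ = d * X]coef0_one.
  by apply: wsum_homog; apply: wtvecZ; apply: wtvec1.
- have -> : (rC (xb i)).@[fixpt] = \sum_(w <- wd_supp D) f w (wd_comp D i w).
    rewrite (bigD1_seq 0) ?wd_mem0 ?wd_uniq //= /f eqxx big1 => [|w /negPf -> //].
    rewrite addr0 -[RHS]/(fixpt i) resC_xbar; case: ifP => [_|/negbT /fixpt_out ->].
      by rewrite mevalXU.
    by rewrite meval0.
  exact: wsum_comp.
- by rewrite !raddfD; apply: wsumD.
have [s sh [pE dpE]] := IHp; have [s' sh' [qE dqE]] := IHq.
exists [seq (a.1 + b.1, a.2 * b.2) | a <- s, b <- s'].
  by move=> _ /allpairsP[[u v] /= [/sh hu /sh' hv ->]]; apply: wtvecM.
split.
  rewrite rmorphM /= pE qE mulr_suml big_allpairs_dep; apply: eq_bigr => u _.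
  by rewrite mulr_sumr.
rewrite !rmorphM /= dpE dqE mulr_suml big_allpairs_dep big_seq [RHS]big_seq.
apply: eq_bigr => u /sh hu; rewrite mulr_sumr big_seq [RHS]big_seq.
apply: eq_bigr => v /sh' hv; rewrite /f /=.
have [u0|u0] := eqVneq u.1 0.
  rewrite u0 add0r; case: ifP => _; last by rewrite mulr0.
  by rewrite coef0_mul.
rewrite mul0r; case: eqP => // uv0; rewrite coef0_mul.
have [v0|v0] := eqVneq v.1 0; first by move: u0; rewrite -uv0 v0 addr0 eqxx.
have huv : wtvec h 0 (u.2 * v.2) by rewrite -uv0; apply: wtvecM.
have := resC_wt0 huv; rewrite rmorphM /= => Cuv.
suff [z|z] : rC u.2 = 0 \/ rC v.2 = 0.
- have /(congr1 (mcoeff 0%MM)) := z; rewrite mcoeff_resC msupport0 sub0set mcoeff0.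
  by move=> ->; rewrite mul0r.
- have /(congr1 (mcoeff 0%MM)) := z; rewrite mcoeff_resC msupport0 sub0set mcoeff0.
  by move=> ->; rewrite mulr0.
have [z|zu] := eqVneq (rC u.2) 0; [by left | right].
apply/eqP; apply: contraT => zv; case/eqP: (zu); apply: (resC_wt_neq0 u0 hu).
have := congr1 (fun p : {mpoly k[n]} => msize p) Cuv.
rewrite msizeM // msizeC.
have := zv; rewrite -(msize_poly_eq0 (rC v.2)).
case: (msize (rC v.2)) => // d _; rewrite addnS /= => e.
by apply: leq_trans (leq_addr d _) _; rewrite e leq_b1.
Qed.

Lemma fixpt_wt w a : wtvec h w a -> (rC a).@[fixpt] = f w a.
Proof.
move=> aw; apply: (wsum_fun char0 _ _ (fixpt_wsum a) (wsum_homog _ aw)).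
- by move=> u; rewrite /f raddf0 if_same.
- by move=> u a' b'; rewrite /f; case: ifP; rewrite ?addr0 // raddfD.
Qed.

End FixedPoint.

Section Translation.
Variables (k : fieldType) (n : nat) (Delta : simplicial_complex n).
Local Notation R := (SRring k Delta).
Local Notation xb := (@xbar k n Delta).
Local Notation C := (cone_set Delta).

(** Translations along C preserve the relations because every face stays a face when
    cone vertices are added. *)
Lemma translation_subproof (q : 'I_n -> k) :
  (forall i, i \notin C -> q i = 0) ->
  exists f : {lrmorphism R -> R}, forall i, f (xb i) = xb i + (q i)%:A.
Proof.
move=> qC; apply: SRlift_subproof => s sD.
have sCD : s :\: C \notin faces Delta.
  apply: contra sD => /cone_face; apply: sc_closed.
  by rewrite setDE setUIl (setUC (~: C)) setUCr setIT subsetUl.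
rewrite (big_setID C) /= [X in _ * X](eq_bigr xb) => [|i].
  by rewrite [X in _ * X](eqP (etrans (prod_xbar_eq0 k Delta _) sCD)) mulr0.
by rewrite inE => /andP[/qC -> _]; rewrite scale0r addr0.
Qed.

Lemma exists_translation (q : 'I_n -> k) :
  (forall i, i \notin C -> q i = 0) ->
  exists tau : AutX k Delta, forall i,
    tau (xb i) = xb i - (q i)%:A /\ aut_inv tau (xb i) = xb i + (q i)%:A.
Proof.
move=> qC; have [g gE] := translation_subproof qC.
have [f fE] : exists f : {lrmorphism R -> R}, forall i, f (xb i) = xb i + (- q i)%:A.
  by apply: translation_subproof => i /qC ->; rewrite oppr0.
have fK : cancel f g.
  apply: (@eq_lrmorph_SR _ _ _ _ (g \o f) idfun) => i /=.
  rewrite fE rmorphD /= gE linearZ /= rmorph1.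
  by rewrite scaleNr addrK.
have gK : cancel g f.
  apply: (@eq_lrmorph_SR _ _ _ _ (f \o g) idfun) => i /=.
  by rewrite gE rmorphD /= fE linearZ /= rmorph1 scaleNr addrNK.
by exists (AlgAut fK gK) => i /=; rewrite fE gE scaleNr.
Qed.

End Translation.

Section FixOrigin.
Variables (k : fieldType) (n : nat) (Delta : simplicial_complex n).
Hypothesis char0 : [pchar k] =i pred0.
Local Notation R := (SRring k Delta).
Local Notation xb := (@xbar k n Delta).

Definition conj_by (m : nat) (g : AutX k Delta) (h : torus k m -> AutX k Delta) t :
  AutX k Delta := (g^-1 * h t * g)%g.

(** Conjugating by the translation that moves the fixed point to the origin: the
    components of weight 0 are corrected by the coordinates of the point, and then
    all components vanish at the origin. *)
Lemma fix_origin (h : torus k n -> AutX k Delta) (D : weight_dec h) :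
  spans_weights D ->
  exists tau : AutX k Delta, exists2 D' : weight_dec (conj_by tau h),
    spans_weights D' & forall i w, coef 0%MM (wd_comp D' i w) = 0.
Proof.
move=> sD; have [c dc] := exists_frame D.
pose p := fixpt D; have pC i := fixpt_out char0 D (i := i).
have [tau tauE] := exists_translation pC; exists tau.
pose u i w := aut_inv tau (wd_comp D i w - (if w == 0 then (p i)%:A else 0)).
have u_out i w : w \notin wd_supp D -> u i w = 0.
  move=> wW; rewrite /u (wd_out i wW) sub0r; case: eqP => [w0|_].
    by rewrite w0 wd_mem0 in wW.
  by rewrite oppr0 raddf0.
have u_sum i : xb i = \sum_(w <- wd_supp D) u i w.
  rewrite /u -raddf_sum /= sumrB -(wd_sum D) (bigD1_seq 0) ?wd_uniq ?wd_mem0 //=.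
  rewrite eqxx big1 ?addr0 => [|w /negPf ->] //.
  by rewrite -(tauE i).1 aut_funK.
have u_wt i w : wtvec (conj_by tau h) w (u i w).
  move=> t; rewrite /= /conj_by /u /= aut_invK -linearZ; congr (aut_inv tau _).
  apply: wtvecD; first exact: wd_homog.
  apply: wtvecN; case: eqP => [->|_]; last exact: wtvec0.
  by apply: wtvecZ; apply: wtvec1.
exists (WeightDec (wd_uniq D) (wd_mem0 D) u_out u_sum u_wt).
  move=> L L0 LD LN Lu j; apply: (sD L L0 LD LN) => i w uw.
  have [->//|w0] := eqVneq w 0; apply: (Lu i).
  rewrite /= /u (negPf w0) subr0; apply: contraNneq uw => /(congr1 tau).
  by rewrite aut_invK raddf0 => ->.
have evE a : coef 0%MM (aut_inv tau a) = (resC k Delta a).@[p].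
  have [P ->] := SRpi_surj a; rewrite !lrmorph_SRpi coef0_peval meval_peval.
  apply: meval_eq => i /=; rewrite (tauE i).2 resC_xbar raddfD /= linearZ /=.
  rewrite coef_xbar eq_sym mnm1_eq0 add0r coef0_one mulr1.
  case: ifP => [_|/negbT iC]; first by rewrite mevalXU.
  by rewrite meval0 pC.
move=> i w /=; rewrite /u evE raddfB mevalB (fixpt_wt char0 sD dc (wd_homog D i w)).
case: eqP => [w0|_]; last by rewrite raddf0 meval0 subrr.
rewrite /= linearZ /= rmorph1 mevalZ meval1 mulr1 w0.
by rewrite subrr.
Qed.

End FixOrigin.

(** * Order of vanishing at the origin *)

Section Order.
Variables (k : fieldType) (n : nat) (Delta : simplicial_complex n).
Local Notation R := (SRring k Delta).
Local Notation pi := (@SRpi k n Delta).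
Local Notation xb := (@xbar k n Delta).
Implicit Types (a b : R) (M : 'X_{1..n}).

(** The order of vanishing at the origin is at least r. *)
Definition ordge (r : nat) a : Prop := forall M, (mdeg M < r)%N -> coef M a = 0.

Lemma ordge0 a : ordge 0 a. Proof. by []. Qed.

Lemma ordgeW r s a : (s <= r)%N -> ordge r a -> ordge s a.
Proof. by move=> sr ra M Ms; apply/ra/(leq_trans Ms). Qed.

Lemma ordge_zero r : ordge r 0.
Proof. by move=> M _; rewrite raddf0. Qed.

Lemma ordgeD r a b : ordge r a -> ordge r b -> ordge r (a + b).
Proof. by move=> ra rb M Mr; rewrite raddfD /= ra ?rb ?addr0. Qed.

Lemma ordgeZ r c a : ordge r a -> ordge r (c *: a).
Proof. by move=> ra M Mr; rewrite linearZ /= ra ?mulr0. Qed.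

Lemma ordgeB r a b : ordge r a -> ordge r b -> ordge r (a - b).
Proof. by move=> ra rb; rewrite -scaleN1r; apply/ordgeD/ordgeZ. Qed.

Lemma ordgeM r s a b : ordge r a -> ordge s b -> ordge (r + s) (a * b).
Proof.
have [p ->] := SRpi_surj a; have [q ->] := SRpi_surj b => rp sq M Mrs.
rewrite -rmorphM coef_pi; case: ifP => // MD.
rewrite mcoeffM big1 // => -[b1 b2] /= /eqP.
move: (bmnm b1) (bmnm b2) => m1 m2 Mm {b1 b2}.
have [D1 D2] : msupport m1 \in faces Delta /\ msupport m2 \in faces Delta.
  have mS : msupport M = msupport m1 :|: msupport m2 by rewrite -msupportD -Mm.
  by move: MD; rewrite mS => MD; split;
    apply: sc_closed MD; rewrite ?subsetUl ?subsetUr.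
have [m1r|m1r] := ltnP (mdeg m1) r.
  by have := rp _ m1r; rewrite coef_pi D1 => ->; rewrite mul0r.
have m2s : (mdeg m2 < s)%N.
  have mS : mdeg M = (mdeg m1 + mdeg m2)%N by rewrite -mdegD -Mm.
  by rewrite -(ltn_add2l r); apply: leq_ltn_trans Mrs; rewrite mS leq_add2r.
by have := sq _ m2s; rewrite coef_pi D2 => ->; rewrite mulr0.
Qed.

Lemma ordge_prod (I : Type) (s : seq I) (r : I -> nat) (a : I -> R) :
  (forall i, ordge (r i) (a i)) -> ordge (\sum_(i <- s) r i) (\prod_(i <- s) a i).
Proof.
move=> ra; apply: (big_ind2 ordge) => // r1 a1 r2 a2.
exact: ordgeM.
Qed.

Lemma ordgeX r a d : ordge r a -> ordge (d * r) (a ^+ d).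
Proof.
move=> ra; elim: d => [|d IH]; first exact: ordge0.
by rewrite exprS mulSn; apply: ordgeM.
Qed.

Lemma ordge_mono (y : 'I_n -> R) M :
  (forall i, ordge 1 (y i)) -> ordge (mdeg M) (\prod_i y i ^+ M i).
Proof.
move=> y1; rewrite mdegE; apply: ordge_prod => i.
by have := ordgeX (d := M i) (y1 i); rewrite muln1.
Qed.

Lemma ordge1P a : coef 0%MM a = 0 -> ordge 1 a.
Proof. by move=> a0 M; rewrite ltnS leqn0 mdeg_eq0 => /eqP ->. Qed.

Lemma ordge_eq0 a : (forall r, ordge r a) -> a = 0.
Proof. by move=> ra; apply: SR_eq0P => M; apply: (ra (mdeg M).+1). Qed.

Lemma normal_form a :
  a = \sum_(M <- msupp (repr a : {mpoly k[n]})) coef M a *: \prod_i xb i ^+ M i.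
Proof.
rewrite -[LHS]pi_repr {1}(mpolyE (repr a)) raddf_sum; apply: eq_bigr => M _ /=.
have -> : \prod_i xb i ^+ M i = pi 'X_[M] by rewrite SRpiE pevalXm.
rewrite SRpiZ; have [MD|MD] := boolP (msupport M \in faces Delta).
  by rewrite -{2}(pi_repr a) coef_pi MD.
by rewrite (SRpi_eq0 _ _).2 ?scaler0 //; apply: mono_nonface.
Qed.

(** An automorphism fixing the origin respects the order of vanishing there. *)
Lemma ordge_aut r a (f : AutX k Delta) :
  (forall i, coef 0%MM (f (xb i)) = 0) -> ordge r a -> ordge r (f a).
Proof.
move=> f0 ra; rewrite [a]normal_form raddf_sum; apply: (big_ind (ordge r)).
- exact: ordge_zero.
- exact: ordgeD.
move=> M _; rewrite /= linearZ /=; have [Mr|Mr] := ltnP (mdeg M) r.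
  by rewrite ra // scale0r; apply: ordge_zero.
apply: ordgeZ; apply: (ordgeW Mr); rewrite rmorph_prod.
rewrite (eq_bigr (fun i => f (xb i) ^+ M i)) => [|i _]; last exact: rmorphXn.
by apply: ordge_mono => i; apply: ordge1P.
Qed.

Section Approx.
Variable y : 'I_n -> R.
Hypothesis y0 : forall i, coef 0%MM (y i) = 0.
Hypothesis dy : \det (linpart y) != 0.

(** P is the leading form of a, of degree r, in the coordinates y. *)
Definition approx r a (P : {mpoly k[n]}) : Prop :=
  [/\ ordge r a, P \is r.-homog & ordge r.+1 (a - peval y P)].

Lemma approx_ord r a P : approx r a P -> ordge r (peval y P).
Proof.
move=> [ra _ rP]; rewrite -(subKr a (peval y P)); apply: ordgeB => //.
exact: ordgeW rP.
Qed.

Lemma approx0 r a : ordge r.+1 a -> approx r a 0.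
Proof.
move=> ra; split; first exact: ordgeW ra.
  exact: dhomog0.
by rewrite raddf0 subr0.
Qed.

Lemma approxD r a b P Q : approx r a P -> approx r b Q -> approx r (a + b) (P + Q).
Proof.
move=> [ra rP aP] [rb rQ bQ]; split; [exact: ordgeD | exact: dhomogD |].
by rewrite raddfD opprD addrACA; apply: ordgeD.
Qed.

Lemma approxZ r c a P : approx r a P -> approx r (c *: a) (c *: P).
Proof.
move=> [ra rP aP]; split; [exact: ordgeZ | exact: dhomogZ |].
by rewrite linearZ -scalerBr; apply: ordgeZ.
Qed.

Lemma approxM r s a b P Q : approx r a P -> approx s b Q -> approx (r + s) (a * b) (P * Q).
Proof.
move=> aP bQ; have oP := approx_ord aP; have oQ := approx_ord bQ.
move: aP bQ => [ra rP aP] [rb rQ bQ]; split; [exact: ordgeM | exact: dhomogM |].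
have -> : a * b - peval y (P * Q) = a * (b - peval y Q) + (a - peval y P) * peval y Q.
  by rewrite rmorphM mulrBr mulrBl addrA addrNK.
by apply: ordgeD; [rewrite -addnS | rewrite -addSn]; apply: ordgeM.
Qed.

Lemma approx1 : approx 0 1 1.
Proof.
split; [exact: ordge0 | exact: dhomog1 |].
by rewrite rmorph1 subrr; apply: ordge_zero.
Qed.

(** To first order the x_j are linear combinations of the y_i, with the inverse of
    the matrix of linear parts. *)
Lemma approx_xbar j : exists P, approx 1 (xb j) P.
Proof.
pose B := invmx (linpart y); exists (\sum_i B j i *: 'X_i); split.
- by apply: ordge1P; rewrite coef_xbar eq_sym mnm1_eq0.
- apply: rpred_sum => i _; apply: dhomogZ; rewrite dhomogX; apply/eqP/mdeg1.
move=> M; rewrite ltnS leq_eqVlt => /orP[/mdeg1P[l /eqP ->]|]; last first.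
  rewrite ltnS leqn0 mdeg_eq0 => /eqP ->.
  rewrite raddfB /= coef_xbar eq_sym mnm1_eq0 sub0r coef0_peval; apply/eqP.
  rewrite oppr_eq0 (raddf_sum (meval _)) big1 //= => i _.
  by rewrite mevalZ mevalXU y0 mulr0.
have -> : peval y (\sum_i B j i *: 'X_i) = \sum_i B j i *: y i.
  by rewrite (raddf_sum (peval y)); apply: eq_bigr => i _; rewrite /= linearZ /= pevalX.
rewrite raddfB /= coef_xbar eq_mnm1 raddf_sum /=.
have /matrixP/(_ j l) : B *m linpart y = 1%:M by rewrite mulVmx // unitmxE unitfE.
rewrite !mxE eq_sym => <-; apply/eqP.
rewrite subr_eq0; apply/eqP/eq_bigr => i _.
by rewrite linearZ !mxE.
Qed.

Lemma exists_approx r a : ordge r a -> exists P, approx r a P.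
Proof.
move=> ra; rewrite [a]normal_form; apply: (big_ind (fun b => exists P, approx r b P)).
- by exists 0; apply/approx0/ordge_zero.
- by move=> b b' [P bP] [P' bP']; exists (P + P'); apply: approxD.
move=> M _; have [Mr|Mr] := ltnP (mdeg M) r.
  by rewrite ra // scale0r; exists 0; apply/approx0/ordge_zero.
have xM : ordge (mdeg M) (\prod_i xb i ^+ M i).
  by apply: ordge_mono => i; apply: ordge1P; rewrite coef_xbar eq_sym mnm1_eq0.
have [rM|Mr'] := ltnP r (mdeg M).
  by exists 0; apply/approx0/ordgeZ/(ordgeW rM).
have <- : mdeg M = r by apply/eqP; rewrite eqn_leq Mr Mr'.
suff [P aP] : exists P, approx (mdeg M) (\prod_i xb i ^+ M i) P.
  by exists (coef M a *: P); apply: approxZ.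
rewrite mdegE; apply: (big_ind2 (fun d b => exists P, approx d b P)).
- by exists 1; apply: approx1.
- by move=> d b d' b' [P bP] [P' bP']; exists (P * P'); apply: approxM.
move=> i _; have [P xP] := approx_xbar i; exists (P ^+ M i).
elim: (M i) => [|d IH]; first exact: approx1.
by rewrite !exprS -[d.+1]add1n; apply: approxM.
Qed.

Lemma coef0_pevalE P : coef 0%MM (peval y P) = P@_0%MM.
Proof.
rewrite coef0_peval; elim/mpoly_ring_ind: P => [d|i|p q|p q].
- by rewrite mevalC mcoeffC eqxx mulr1.
- by rewrite mevalXU y0 mcoeffX mnm1_eq0.
- by rewrite mevalD mcoeffD => -> ->.
- by rewrite mevalM (rmorphM (mcoeff 0%MM)) => -> ->.
Qed.

Lemma coef1_pevalE P l :
  coef U_(l)%MM (peval y P) = \sum_j P@_U_(j)%MM * coef U_(l)%MM (y j).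
Proof.
have d (p : {mpoly k[n]}) j : p@_U_(j) = (p^`M(j))@_0.
  by rewrite mcoeff_mderiv mnm0E add0m.
elim/mpoly_ring_ind: P => [c|i|p q IHp IHq|p q IHp IHq].
- rewrite pevalC linearZ /= big1 => [|j _].
    by rewrite -(rmorph1 pi) coef_pi msupportU sc_vertex mcoeff1 mnm1_eq0 mulr0.
  by rewrite mcoeffC mnm1_eq0 mulr0 mul0r.
- rewrite pevalX (bigD1 i) //= mcoeffX eqxx mul1r big1 ?addr0 // => j ji.
  by rewrite mcoeffX eq_mnm1 eq_sym (negPf ji) mul0r.
- rewrite !raddfD /= IHp IHq -big_split; apply: eq_bigr => j _.
  by rewrite mcoeffD mulrDl.
rewrite rmorphM coef1_mul IHp IHq !coef0_pevalE mulr_suml mulr_sumr -big_split.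
apply: eq_bigr => j _ /=; rewrite [(p * q)@__]d mderivM mcoeffD.
rewrite !(rmorphM (mcoeff 0%MM)) /= -!d mulrDl mulrA; congr (_ + _).
by rewrite mulrAC.
Qed.

End Approx.
End Order.

(** * Weight vectors are monomials in a frame *)

Section WeightVectors.
Variables (k : fieldType) (n : nat) (Delta : simplicial_complex n) (m : nat).
Hypothesis char0 : [pchar k] =i pred0.
Local Notation R := (SRring k Delta).
Local Notation weight := 'rV[int]_m.
Variables (h : torus k m -> AutX k Delta).
Variables (y : 'I_n -> R) (c : 'I_n -> weight).
Hypothesis yc : forall i, wtvec h (c i) (y i).

Definition wtmono (M : 'X_{1..n}) : weight := \sum_i c i *+ M i.

Lemma wtvec_mono M : wtvec h (wtmono M) (\prod_i y i ^+ M i).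
Proof. by apply: wtvec_prod => i _; apply: wtvecX. Qed.

Lemma wtk_wtmono M : wtk k (wtmono M) = (\row_i (M i)%:R) *m wtmx k c.
Proof.
apply/matrixP => a b; rewrite !mxE summxE rmorph_sum.
apply: eq_bigr => i _; rewrite /= !mxE ord1 mulmxnE rmorphMn /=.
by rewrite mulr_natl.
Qed.

(** When distinct monomials have distinct weights, the relations among the y_i are
    spanned by monomials. *)
Lemma peval_wt_eq0 (Q : {mpoly k[n]}) : injective wtmono -> peval y Q = 0 ->
  forall M, Q@_M != 0 -> \prod_i y i ^+ M i = 0.
Proof.
move=> inj Q0 M QM; pose s := [seq (wtmono N, Q@_N *: \prod_i y i ^+ N i) | N <- msupp Q].
have sh p : p \in s -> wtvec h p.1 p.2.
  by case/mapP => N _ ->; apply: wtvecZ; apply: wtvec_mono.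
have s0 : \sum_(p <- s) p.2 = 0 by rewrite big_map -[RHS]Q0 pevalE.
pose f (w : weight) (a : R) : R := if w == wtmono M then a else 0.
have f0 w : f w 0 = 0 by rewrite /f if_same.
have fD w x z : f w (x + z) = f w x + f w z by rewrite /f; case: ifP; rewrite ?addr0.
have := wtvec_indep char0 f0 fD sh s0; rewrite big_map /f /= (bigD1_seq M) ?msupp_uniq //=.
  rewrite eqxx [X in _ + X]big1 ?addr0 => [/eqP|N NM]; last first.
    by case: ifP => // /eqP/inj NM1; rewrite NM1 eqxx in NM.
  by rewrite scaler_eq0 (negPf QM) => /eqP.
by rewrite mcoeff_msupp.
Qed.

(** k[Delta] is reduced, so a vanishing monomial has a vanishing radical. *)
Lemma mono_eq0 M (G : {set 'I_n}) : msupport M \subset G ->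
  \prod_i y i ^+ M i = 0 -> \prod_(i in G) y i = 0.
Proof.
move=> MG M0; apply: (@SR_nilp _ _ _ _ (mdeg M)); rewrite -prodrXl.
transitivity (\prod_(i in G) y i ^+ M i * \prod_(i in G) y i ^+ (mdeg M - M i)).
  rewrite -big_split; apply: eq_bigr => i _ /=; rewrite -exprD subnKC //.
  by rewrite mdegE (bigD1 i) //= leq_addr.
have -> : \prod_(i in G) y i ^+ M i = \prod_i y i ^+ M i.
  rewrite [RHS](bigID (mem G)) /= [X in _ * X]big1 ?mulr1 // => i iG.
  have : i \notin msupport M by apply: contra iG; apply/subsetP.
  by rewrite mem_support negbK => /eqP ->.
by rewrite M0 mul0r.
Qed.

End WeightVectors.

Section Linearization.
Variables (k : fieldType) (n : nat) (Delta : simplicial_complex n).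
Hypothesis char0 : [pchar k] =i pred0.
Local Notation R := (SRring k Delta).
Local Notation pi := (@SRpi k n Delta).
Local Notation xb := (@xbar k n Delta).
Local Notation weight := 'rV[int]_n.
Variables (h : torus k n -> AutX k Delta) (D : weight_dec h).
Hypothesis sD : spans_weights D.
Hypothesis D0 : forall i w, coef 0%MM (wd_comp D i w) = 0.

Lemma aut_coef0 t i : coef 0%MM (h t (xb i)) = 0.
Proof.
rewrite (wd_sum D) !raddf_sum big1 //= => w _.
by rewrite (wd_homog D) linearZ /= D0 mulr0.
Qed.

(** The weights of a frame are linearly independent, so they tell monomials apart. *)
Lemma wtmono_inj (y : 'I_n -> R) (c : 'I_n -> weight) :
  (forall i, wtvec h (c i) (y i)) -> \det (linpart y) != 0 -> injective (wtmono c).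
Proof.
move=> yc dy M N e; have u := wtmx_unit char0 sD yc dy.
have : (\row_i (M i)%:R : 'rV[k]_n) = \row_i (N i)%:R.
  apply: (can_inj (mulmxK u)); by rewrite -!wtk_wtmono e.
move=> /matrixP MN; apply/mnmP => i; have := MN 0 i; rewrite !mxE.
exact: natr_inj.
Qed.

Section Frame.
Variables (y : 'I_n -> R) (c : 'I_n -> weight).
Hypothesis yc : forall i, wtvec h (c i) (y i).
Hypothesis y0 : forall i, coef 0%MM (y i) = 0.
Hypothesis dy : \det (linpart y) != 0.

Let winj : injective (wtmono c) := wtmono_inj yc dy.

(** The remainder of the approximation keeps its order under the torus, so it is
    small in each weight separately, and the terms of the leading form of other
    weights can be dropped. *)
Lemma leading_form_of_weight w z r : wtvec h w z -> ordge r z ->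
  exists2 P : {mpoly k[n]}, P \is r.-homog &
    forall M, (mdeg M < r.+1)%N ->
      coef M z = \sum_(N <- msupp P | wtmono c N == w) P@_N * coef M (\prod_i y i ^+ N i).
Proof.
move=> zw rz; have [P [_ rP zP]] := exists_approx y0 dy rz; exists P => // M Mr.
pose s : seq (weight * k^o) := (w, coef M z) ::
  [seq (wtmono c N, - (P@_N * coef M (\prod_i y i ^+ N i))) | N <- msupp P].
have s0 t : \sum_(p <- s) chi p.1 t *: p.2 = 0.
  have := ordge_aut (aut_coef0 t) zP Mr.
  rewrite raddfB /= zw raddfB /= linearZ /= => zE; rewrite -[RHS]zE.
  rewrite /s big_cons big_map /=; congr (_ + _).
  rewrite pevalE (raddf_sum (h t)) (raddf_sum (coef M)) -sumrN /=.
  apply: eq_bigr => N _ /=.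
  rewrite linearZ /= (wtvec_mono yc) linearZ /= linearZ /= scalerN.
  by rewrite -[_ *: (_ * _)]/(_ * (_ * _)) mulrCA.
have := lindep char0 s0 w; rewrite lcoef_cons eqxx /lcoef big_map /= => /eqP.
by rewrite sumrN subr_eq0 => /eqP ->.
Qed.

(** The order of z can only stop growing at the degree of a monomial of weight w. *)
Lemma ordge_unless_degree w z r : wtvec h w z -> ordge r z ->
  (forall M, wtmono c M = w -> mdeg M != r) -> ordge r.+1 z.
Proof.
move=> zw rz wr M Mr; have [P rP ->] := leading_form_of_weight zw rz => //.
rewrite big_seq_cond big1 // => N /andP[NP /eqP Nw].
by move/dhomogP: rP => /(_ _ NP) e; case/eqP: (wr _ Nw).
Qed.

(** At most one monomial M has weight w. Subtracting the multiple of it that matches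
    the leading form leaves an element of weight w whose order grows for ever. *)
Lemma wtvec_monomial w z : wtvec h w z ->
  z = 0 \/ exists M d, wtmono c M = w /\ z = d *: \prod_i y i ^+ M i.
Proof.
move=> zw; have [[M Mw]|noM] := pselect (exists M, wtmono c M = w); last first.
  left; apply: ordge_eq0; elim=> [|r IH]; first exact: ordge0.
  by apply: ordge_unless_degree zw IH _ => M Mw; case: noM; exists M.
right; exists M.
have rz : ordge (mdeg M) z.
  have H r : (r <= mdeg M)%N -> ordge r z.
    elim: r => [|r IH] rM; first exact: ordge0.
    apply: ordge_unless_degree zw (IH (ltnW rM)) _ => N Nw.
    by rewrite (winj (etrans Nw (esym Mw))) gtn_eqF.
  exact: H.
have [P rP zP] := leading_form_of_weight zw rz; exists P@_M; split=> //.
apply/eqP; rewrite -subr_eq0; apply/eqP; set z' := z - _.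
have z'w : wtvec h w z'.
  by apply: wtvecD zw (wtvecN (wtvecZ _ _)); rewrite -Mw; apply: wtvec_mono.
have rz' : ordge (mdeg M).+1 z'.
  move=> N NM; rewrite raddfB /= zP // linearZ /=.
  have [MP|MP] := boolP (M \in msupp P); last first.
    rewrite (memN_msupp_eq0 MP) mul0r subr0 big_seq_cond big1 // => N' /andP[NP].
    by rewrite -Mw => /eqP/winj e; rewrite -e NP in MP.
  rewrite big_mkcond (bigD1_seq M) ?msupp_uniq //= Mw eqxx.
  rewrite [X in _ + X - _]big1 ?addr0 ?subrr // => N' N'M.
  by rewrite -Mw; case: ifP => // /eqP/winj e; rewrite e eqxx in N'M.
have H d : ordge ((mdeg M).+1 + d) z'.
  elim: d => [|d IH]; first by rewrite addn0.
  rewrite addnS; apply: ordge_unless_degree z'w IH _ => N Nw.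
  by rewrite (winj (etrans Nw (esym Mw))) addSn ltn_eqF // ltnS leq_addr.
by apply: ordge_eq0 => r; apply: (ordgeW _ (H r)); rewrite leq_addl.
Qed.

Lemma frame_generates : exists P : 'I_n -> {mpoly k[n]}, forall i, xb i = peval y (P i).
Proof.
suff H i : exists P : {mpoly k[n]}, xb i = peval y P by have [P xP] := choice H; exists P.
rewrite (wd_sum D); apply: (big_ind (fun a => exists P : {mpoly k[n]}, a = peval y P)).
- by exists 0; rewrite raddf0.
- by move=> a b [P ->] [Q ->]; exists (P + Q); rewrite raddfD.
move=> w _; have [->|[M [d [_ ->]]]] := wtvec_monomial (wd_homog D i w).
  by exists 0; rewrite raddf0.
by exists (d *: 'X_[M]); rewrite linearZ /= pevalXm.
Qed.

(** The weights of the action generate Z^n and are sums of the c_i. *)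
Lemma frame_unimodular : exists Z : 'M[int]_n, (\matrix_i c i) *m Z = 1%:M.
Proof.
pose L w := exists z : 'rV[int]_n, w = z *m \matrix_i c i.
have H j : L (delta_mx 0 j).
  apply: (sD (L := L)).
  - by exists 0; rewrite mul0mx.
  - by move=> _ _ [z ->] [z' ->]; exists (z + z'); rewrite mulmxDl.
  - by move=> _ [z ->]; exists (- z); rewrite mulNmx.
  move=> i w uw; have [u0|[M [d [<- _]]]] := wtvec_monomial (wd_homog D i w).
    by rewrite u0 eqxx in uw.
  exists (\row_j (M j)%:Z); apply/matrixP => a b; rewrite ord1 summxE !mxE.
  by apply: eq_bigr => l _; rewrite mulmxnE !mxE -mulr_natl natz.
have [Z Zj] := choice H; exists (\matrix_j Z j); apply: mulmx1C.
apply/row_matrixP => j; rewrite row_mul rowK -Zj.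
by apply/matrixP => a b; rewrite !mxE ord1 eqxx eq_sym.
Qed.

(** Let s be a permutation with dy_i / dx_(s i) nonzero at the origin. On the
    coordinate subspace of a face that contains all s i, i in F, no y_i with i in F
    vanishes identically. *)
Lemma frame_faces_lower : exists s : 'S_n, forall F : {set 'I_n},
  \prod_(i in F) y i = 0 -> s @: F \notin faces Delta.
Proof.
have [s s0] := det_neq0_perm dy; exists s => F yF; apply/negP => GD.
have := congr1 (resR k GD) yF; rewrite raddf0 rmorph_prod => /eqP /prodf_eq0[i iF /eqP].
move=> /(congr1 (mcoeff U_(s i)%MM)); rewrite mcoeff_resR msupportU sub1set mcoeff0.
by rewrite imset_f // => e; case/eqP: (s0 i); rewrite mxE.
Qed.

(** The same argument with the roles of x and y exchanged. Restriction of polynomials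
    in y to a coordinate subspace makes sense because the relations among the y_i
    are spanned by monomials. *)
Lemma frame_faces_upper : exists p : 'S_n, forall F : {set 'I_n},
  F \notin faces Delta -> \prod_(i in F) y (p i) = 0.
Proof.
have [P xP] := frame_generates; pose B : 'M[k]_n := \matrix_(i, j) (P i)@_U_(j)%MM.
have BA : B *m linpart y = 1%:M.
  apply/matrixP => i l; rewrite !mxE; have := coef_xbar k Delta U_(l)%MM i.
  rewrite {1}xP coef1_pevalE // eq_mnm1 eq_sym => <-.
  by apply: eq_bigr => j _; rewrite !mxE.
have dB : \det B != 0.
  by apply: contraTneq (oner_neq0 k) => dB; rewrite -(det1 k n) -BA det_mulmx dB mul0r eqxx.
have [p p0] := det_neq0_perm dB; exists p => F FD.
have Q0 : peval y (\prod_(i in F) P i) = 0.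
  rewrite rmorph_prod -[RHS](eqP (etrans (prod_xbar_eq0 k Delta F) FD)).
  by apply: eq_bigr => i _; rewrite xP.
have QM := peval_wt_eq0 char0 yc winj Q0.
rewrite -(big_imset y (h := p)) /=; last by move=> a b _ _; apply: perm_inj.
set G := [set _ | _ in _]; apply/eqP; apply: contraT => /eqP yG.
have : restr G (\prod_(i in F) P i) = 0.
  apply/mpolyP => M; rewrite mcoeff_restr mcoeff0; case: ifP => // MG.
  apply/eqP; apply: contraT => /QM yM; case: yG; exact: mono_eq0 MG yM.
rewrite rmorph_prod => /eqP/prodf_eq0[i iF /eqP].
move=> /(congr1 (mcoeff U_(p i)%MM)); rewrite mcoeff_restr msupportU sub1set mcoeff0.
by rewrite imset_f // => e; case/eqP: (p0 i); rewrite mxE.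
Qed.

(** The two previous permutations compose to an injection of the set of subsets under
    which the preimage of Delta lies in Delta; by counting it equals Delta. *)
Lemma frame_faces : exists p : 'S_n, forall F : {set 'I_n},
  (\prod_(i in F) y (p i) == 0) = (F \notin faces Delta).
Proof.
have [s sP] := frame_faces_lower; have [p pP] := frame_faces_upper; exists p => F.
apply/idP/idP => [/eqP yF|/pP ->]; last by rewrite eqxx.
have prodp (E : {set 'I_n}) : \prod_(i in E) y (p i) = \prod_(i in p @: E) y i.
  by rewrite big_imset //=; move=> a b _ _; apply: perm_inj.
pose f (E : {set 'I_n}) := s @: (p @: E).
have f_inj : injective f by move=> E1 E2 /(imset_inj (@perm_inj _ s))/(imset_inj (@perm_inj _ p)).
have sub : f @^-1: faces Delta \subset faces Delta.
  apply/subsetP => E; rewrite inE; apply: contraLR => /pP.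
  by rewrite prodp; apply: sP.
have : f @^-1: faces Delta = faces Delta.
  by apply/eqP; rewrite eqEcard sub on_card_preimset ?leqnn //; apply: onW_bij; apply: injF_bij.
move=> /setP/(_ F); rewrite inE => <-; apply: sP; by rewrite -prodp.
Qed.

End Frame.
End Linearization.

(** * Linearization *)

Section Conjugation.
Variables (k : fieldType) (n : nat) (Delta : simplicial_complex n).
Hypothesis char0 : [pchar k] =i pred0.
Local Notation R := (SRring k Delta).
Local Notation pi := (@SRpi k n Delta).
Local Notation xb := (@xbar k n Delta).

(** The inverse is built from preimages of the generators; injectivity shows that they
    satisfy the relations. *)
Lemma bij_lrmorph_aut (f : {lrmorphism R -> R}) :
  injective f -> (forall a, exists b, f b = a) -> exists g : AutX k Delta, g =1 f.
Proof.
move=> f_inj /choice[u fu].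
have [v vE] : exists v : {lrmorphism R -> R}, forall i, v (xb i) = u (xb i).
  apply: SRlift_subproof => s sD; apply: f_inj; rewrite raddf0 rmorph_prod.
  rewrite -[RHS](eqP (etrans (prod_xbar_eq0 k Delta s) sD)).
  by apply: eq_bigr => i _; rewrite /= fu.
have vK : cancel v f.
  by apply: (@eq_lrmorph_SR _ _ _ _ (f \o v) idfun) => i /=; rewrite vE fu.
have fK : cancel f v by move=> a; apply: f_inj; rewrite vK.
by exists (AlgAut fK vK).
Qed.

(** The change of coordinates sends x_i to the frame vector y_(p i), with p the
    permutation that matches the relations. *)
Lemma linearize_at_origin (h : torus k n -> AutX k Delta) (D : weight_dec h) :
  spans_weights D -> (forall i w, coef 0%MM (wd_comp D i w) = 0) ->
  exists g : AutX k Delta,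
    (forall t, exists s, (h t * g)%g = (g * torus_aut k Delta s)%g) /\
    (forall s, exists t, (h t * g)%g = (g * torus_aut k Delta s)%g).
Proof.
move=> sD D0; have [c dc] := exists_frame D.
pose y i := wd_comp D i (c i).
have yc i : wtvec h (c i) (y i) by apply: wd_homog.
have y0 i : coef 0%MM (y i) = 0 by apply: D0.
have [p yF] := frame_faces char0 sD D0 yc y0 dc.
have [P xP] := frame_generates char0 sD D0 yc y0 dc.
have [Z cZ] := frame_unimodular char0 sD D0 yc y0 dc.
have [f fE] : exists f : {lrmorphism R -> R}, forall i, f (xb i) = y (p i).
  by apply: SRlift_subproof => F FD; apply/eqP; rewrite yF.
have ycp i : wtvec h (c (p i)) (y (p i)) by apply: yc.
have dcp : \det (linpart (fun i => y (p i))) != 0.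
  have -> : linpart (fun i => y (p i)) = row_perm p (linpart y).
    by apply/matrixP => i j; rewrite !mxE.
  by rewrite row_permE det_mulmx det_perm mulf_neq0 // signr_eq0.
have inj := wtmono_inj char0 sD ycp dcp.
have f_inj : injective f.
  apply: raddf_inj => a fa; have [q aq] := SRpi_surj a.
  have q0 : peval (fun i => y (p i)) q = 0.
    by rewrite -[RHS]fa aq /= lrmorph_SRpi; apply: eq_peval => i; rewrite /= fE.
  rewrite aq; apply/SRpi_eq0/SRidealP => M MD; apply/eqP; apply: contraT => qM.
  have /(mono_eq0 (subxx (msupport M)))/eqP := peval_wt_eq0 char0 ycp inj q0 qM.
  by rewrite yF MD.
have f_surj a : exists b, f b = a.
  have [q ->] := SRpi_surj a; pose x' j := xb ((p^-1)%g j).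
  exists (peval (fun i => peval x' (P i)) q); rewrite lrmorph_peval SRpiE.
  apply: eq_peval => i /=; rewrite lrmorph_peval xP; apply: eq_peval => j /=.
  by rewrite /x' fE permKV.
have [g gf] := bij_lrmorph_aut f_inj f_surj; exists g.
have conj t (s : torus k n) : (forall i, chi (c (p i)) t = val (s i)) ->
    (h t * g)%g = (g * torus_aut k Delta s)%g.
  move=> ts; apply: algaut_ext.
  apply: (@eq_lrmorph_SR _ _ _ _ (h t \o g) (g \o torus_act s)) => i.
  rewrite /= torus_act_xbar linearZ /= gf fE yc ts.
  by [].
split=> [t|s].
  exists [ffun i => exist _ (chi (c (p i)) t) (chi_neq0 (c (p i)) t)].
  by apply: conj => i; rewrite ffunE.
exists (monomial_map Z [ffun i => s ((p^-1)%g i)]); apply: conj => i.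
rewrite chi_monomial_map; have := row_mul (p i) (\matrix_i c i) Z.
by rewrite rowK => <-; rewrite cZ row1 chi_delta ffunE permK.
Qed.

Theorem linearize (h : torus k n -> AutX k Delta) (D : weight_dec h) :
  spans_weights D ->
  exists g : AutX k Delta,
    (forall t, exists s, (h t * g)%g = (g * torus_aut k Delta s)%g) /\
    (forall s, exists t, (h t * g)%g = (g * torus_aut k Delta s)%g).
Proof.
move=> /(fix_origin char0)[tau [D' sD' D'0]].
have [g [g1 g2]] := linearize_at_origin sD' D'0; exists (tau * g)%g.
have conj t (s : torus k n) : (conj_by tau h t * g)%g = (g * torus_aut k Delta s)%g ->
    (h t * (tau * g))%g = (tau * g * torus_aut k Delta s)%g.
  by rewrite /conj_by -!mulgA => <-; rewrite mulVKg.
split=> [t|s]; [have [s E] := g1 t; exists s | have [t E] := g2 s; exists t];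
  exact: conj.
Qed.

End Conjugation.

(** * Chains of irreducible closed sets *)

Section Chains.
Variables (k : fieldType) (T : Type) (X : affvar k T).
Local Notation Pol := {mpoly k[#|av_idx X|]}.

Lemma irreducible_prime Z (P Q : Pol) : irreducible_closed X Z ->
  (forall x, Z x -> av_eval P x * av_eval Q x = 0) ->
  (forall x, Z x -> av_eval P x = 0) \/ (forall x, Z x -> av_eval Q x = 0).
Proof.
move=> [[S ZS] _ Zirr] PQ.
have cl (F : Pol) : closed_subset X (fun x => X x /\ av_eval F x = 0).
  exists (eq F) => x; split=> -[Xx Fx]; split=> //; last exact: Fx.
  by move=> G <-.
have sub x : Z x -> (X x /\ av_eval P x = 0) \/ (X x /\ av_eval Q x = 0).
  move=> Zx; have [Xx _] := (ZS x).1 Zx.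
  by have /eqP := PQ x Zx; rewrite mulf_eq0 => /orP[] /eqP ?; [left | right].
by have [H|H] := Zirr _ _ (cl P) (cl Q) sub; [left | right] => x /H[].
Qed.

Lemma av_evalM (P Q : Pol) x : av_eval (P * Q) x = av_eval P x * av_eval Q x.
Proof. exact: mevalM. Qed.

Lemma av_evalX (P : Pol) d x : av_eval (P ^+ d) x = av_eval P x ^+ d.
Proof. exact: (rmorphXn (meval _)). Qed.

Definition independent_on (Z : T -> Prop) (I : finType) (F : I -> Pol) : Prop :=
  forall c : I -> k, (forall x, Z x -> \sum_a c a * av_eval (F a) x = 0) ->
  forall a, c a = 0.

(** Let P vanish on Z but not on Z'. In a relation with coefficients in the span of F,
    the lowest power of P can be divided out on the irreducible Z'; restricting to Z
    then kills all but the lowest coefficient. *)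
Lemma independent_step (Z Z' : T -> Prop) (I : finType) (F : I -> Pol) (P : Pol) N :
  irreducible_closed X Z' -> (forall x, Z x -> Z' x) ->
  (forall x, Z x -> av_eval P x = 0) -> (exists2 x, Z' x & av_eval P x != 0) ->
  independent_on Z F ->
  independent_on Z' (fun aj : I * 'I_N => F aj.1 * P ^+ aj.2).
Proof.
move=> irr ZZ' PZ [x0 Z'x0 Px0] indF c cZ' [a j].
suff H i : forall (l : 'I_N) b, (l < i)%N -> c (b, l) = 0.
  by apply: (H N); apply: ltn_ord.
elim: i => [//|i IH] l b; rewrite ltnS leq_eqVlt => /orP[/eqP li|]; last exact: IH.
pose H : Pol := \sum_(bl : I * 'I_N | (i <= bl.2)%N) c bl *: (F bl.1 * P ^+ (bl.2 - i)).
have HE x : av_eval H x =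
    \sum_(bl : I * 'I_N | (i <= bl.2)%N) c bl * (av_eval (F bl.1) x * av_eval P x ^+ (bl.2 - i)).
  rewrite /H /av_eval (raddf_sum (meval _)); apply: eq_bigr => bl _ /=.
  by rewrite mevalZ -[_.@[_]]/(av_eval _ _) av_evalM av_evalX.
have PH x : Z' x -> av_eval (P ^+ i) x * av_eval H x = 0.
  move=> Z'x; rewrite -[RHS](cZ' x Z'x) HE mulr_sumr av_evalX.
  rewrite [RHS](bigID (fun bl : I * 'I_N => (i <= bl.2)%N)) /= [X in _ = _ + X]big1 ?addr0.
    apply: eq_bigr => -[b' l'] /= il'; rewrite av_evalM av_evalX mulrCA; congr (_ * _).
    by rewrite mulrCA -exprD subnKC.
  by move=> [b' l'] /=; rewrite -ltnNge => /IH ->; rewrite mul0r.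
have [P0|H0] := irreducible_prime irr PH.
  by have /eqP := P0 x0 Z'x0; rewrite av_evalX expf_eq0 (negPf Px0) andbF.
apply: (indF (fun b' => c (b', l))) => x Zx; rewrite -[RHS](H0 x (ZZ' _ Zx)) HE.
rewrite (bigID (fun bl : I * 'I_N => bl.2 == l)) /= [X in _ = _ + X]big1 ?addr0.
  rewrite (eq_bigl (fun bl : I * 'I_N => xpredT bl.1 && (bl.2 == l))) => [|[b' l']] /=.
    pose G b' l' := c (b', l') * (av_eval (F b') x * av_eval P x ^+ (l' - i)).
    rewrite (eq_bigr (fun bl => G bl.1 bl.2)) => [|[b' l']] //.
    rewrite -(pair_big xpredT (fun l' => l' == l) G) /= /G.
    by apply: eq_bigr => b' _; rewrite big_pred1_eq li subnn expr0 mulr1.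
  by case: eqP => [->|]; rewrite ?li ?leqnn // andbF.
move=> [b' l'] /= /andP[il' l'l]; rewrite (PZ x Zx) expr0n subn_eq0.
have -> : (l' <= i)%N = false.
  by apply: contraNF l'l => l'i; apply/eqP/val_inj/eqP; rewrite /= li eqn_leq l'i.
by rewrite !mulr0.
Qed.

Lemma chain_separators (Z : nat -> T -> Prop) e :
  (forall i, (i <= e)%N -> irreducible_closed X (Z i)) ->
  (forall i, (i < e)%N -> (forall x, Z i x -> Z i.+1 x) /\ (exists x, Z i.+1 x /\ ~ Z i x)) ->
  exists P : 'I_e -> Pol, forall i : 'I_e,
    (forall x, Z i x -> av_eval (P i) x = 0) /\ (exists2 x, Z i.+1 x & av_eval (P i) x != 0).
Proof.
move=> irr lt.
suff H (i : 'I_e) : exists P : Pol, (forall x, Z i x -> av_eval P x = 0) /\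
    (exists2 x, Z i.+1 x & av_eval P x != 0).
  by have [P PP] := choice H; exists P.
have [ZZ [x [Zx nZx]]] := lt i (ltn_ord i).
have [[S ZS] _ _] := irr i (ltnW (ltn_ord i)).
have [[S' ZS'] _ _] := irr i.+1 (ltn_ord i).
have [Xx _] := (ZS' x).1 Zx.
have [P SP Px] : exists2 P, S P & av_eval P x != 0.
  apply: contrapT => H; apply: nZx; apply/ZS; split=> // P SP.
  by apply/eqP; apply: contrapT => /negP Px; apply: H; exists P.
by exists P; split=> [z /ZS[_ /(_ P SP)]|] //; exists x.
Qed.

End Chains.

Section LaurentDegree.
Variables (k : fieldType) (m : nat).
Local Notation weight := 'rV[int]_m.

Definition wt_bounded (B : nat) (w : weight) : Prop := forall j, (`|w 0%R j| <= B)%N.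

Lemma wt_bounded0 : wt_bounded 0 0.
Proof. by move=> j; rewrite mxE. Qed.

Lemma wt_boundedD B B' w w' :
  wt_bounded B w -> wt_bounded B' w' -> wt_bounded (B + B') (w + w').
Proof.
move=> wB wB' j; rewrite mxE; have := wB j; have := wB' j.
by move: (w 0 j) (w' 0 j) => a b; lia.
Qed.

Lemma laurent_bounded (V : lmodType k) (f : torus k m -> V) :
  laurent (fun _ => True) f -> exists B, laurent (wt_bounded B) f.
Proof.
case=> s _ fE; suff [B sB] : exists B, forall p, p \in s -> wt_bounded B p.1.
  by exists B, s.
elim: s {fE} => [|p s [B IH]]; first by exists 0%N.
exists (B + \sum_j `|p.1 0%R j|)%N => q; rewrite inE => /orP[/eqP ->|/IH qB] j.
  by rewrite (bigD1 j) //=; lia.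
by have := qB j; lia.
Qed.

Lemma laurent_bounded_fin (e : nat) (f : 'I_e -> torus k m -> k^o) :
  (forall i, laurent (fun _ => True) (f i)) ->
  exists B, forall i, laurent (wt_bounded B) (f i).
Proof.
move=> fL; have [B fB] := choice (fun i => laurent_bounded (fL i)).
exists (\sum_i B i)%N => i; apply: laurentS (fB i) => w wB j.
by apply: leq_trans (wB j) _; rewrite (bigD1 i) //= leq_addr.
Qed.

(** The matrix of coefficients, indexed by the functions and by the exponents in the
    box, has independent rows. *)
Lemma laurent_bounded_le (I : finType) (f : I -> torus k m -> k) B :
  (forall a, laurent (V := k^o) (wt_bounded B) (f a)) ->
  (forall c : I -> k, (forall t, \sum_a c a * f a t = 0) -> forall a, c a = 0) ->
  (#|I| <= (2 * B).+1 ^ m)%N.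
Proof.
move=> fB ind; pose box := {ffun 'I_m -> 'I_(2 * B).+1}.
pose wt (b : box) : weight := \row_j ((b j)%:Z - B%:Z).
have wt_inj : injective wt.
  move=> b b' /matrixP e; apply/ffunP => j; apply/val_inj.
  by have := e 0 j; rewrite !mxE /=; lia.
have wt_surj w : wt_bounded B w -> exists b, w = wt b.
  move=> wB; have lt j : (`|(w 0%R j + B%:Z)%R| < (2 * B).+1)%N by have := wB j; lia.
  exists [ffun j => Ordinal (lt j)]; apply/matrixP => i j; rewrite ord1 !mxE ffunE /=.
  by have := wB j; lia.
have H a : exists A : box -> k, forall t, f a t = \sum_b A b * chi (wt b) t.
  have [s sB fE] := fB a; exists (fun b => lcoef s (wt b)) => t; rewrite fE.
  rewrite (lsum (f := fun w (x : k^o) => chi w t *: x) (W := [seq wt b | b <- enum box])).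
  - by rewrite big_map big_enum; apply: eq_bigr => b _; apply: mulrC.
  - by move=> w; rewrite scaler0.
  - by move=> w x y; rewrite scalerDr.
  - by rewrite (map_inj_uniq wt_inj) enum_uniq.
  - by move=> p /sB/wt_surj[b ->]; apply: map_f; rewrite mem_enum.
have [A fA] := choice H.
have card_box : #|box| = ((2 * B).+1 ^ m)%N by rewrite card_ffun !card_ord.
rewrite -card_box; pose M : 'M[k]_(#|I|, #|box|) :=
  \matrix_(i, j) A (enum_val i) (enum_val j).
have /eqP <- : row_free M; last exact: rank_leq_col.
apply: inj_row_free => v vM.
have v0 := ind (fun a => v 0 (enum_rank a)).
apply/matrixP => i j; rewrite ord1 [RHS]mxE -[j]enum_valK; apply: v0 => t.
transitivity (\sum_b (\sum_a v 0 (enum_rank a) * A a b) * chi (wt b) t).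
  under eq_bigr => a _ do rewrite fA mulr_sumr.
  rewrite exchange_big /=; apply: eq_bigr => b _; rewrite mulr_suml.
  by apply: eq_bigr => a _; rewrite mulrA.
rewrite big1 // => b _; have /matrixP/(_ 0 (enum_rank b)) := vM; rewrite !mxE.
rewrite (reindex enum_rank) /=; last exact/onW_bij/enum_rank_bij.
by under eq_bigr => a _ do rewrite !mxE !enum_rankK; move=> ->; rewrite mul0r.
Qed.

Variables (T : Type) (X : affvar k T) (h : torus k m -> T).
Hypothesis hL : forall j : av_idx X, laurent (V := k^o) (fun _ => True) (fun t => av_coord j (h t)).
Hypothesis hX : forall x, X x -> exists t, h t = x.

Lemma growth_le e d C : (forall N, (0 < N)%N -> (N ^ e <= (N * C) ^ d)%N) -> (e <= d)%N.
Proof.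
move=> H; rewrite leqNgt; apply/negP => de; pose N := (C ^ d).+1.
have := H N isT; rewrite expnMn.
have : (N ^ d.+1 <= N ^ e)%N by rewrite leq_pexp2l.
move=> /leq_trans H1 /H1; rewrite expnSr leq_pmul2l ?expn_gt0 //.
by rewrite ltnn.
Qed.

Theorem chain_length_le e : has_chain X e -> (e <= m)%N.
Proof.
move=> [Z [irr lt]]; have [P PP] := chain_separators irr lt.
have PL i : laurent (V := k^o) (fun _ => True) (fun t => av_eval (P i) (h t)).
  by apply: laurent_meval.
have [B PB] := laurent_bounded_fin PL.
apply: (@growth_le _ _ (2 * (e * B)).+1) => N N0.
suff H r : (r <= e)%N -> exists (I : finType) (F : I -> {mpoly k[#|av_idx X|]}),
    [/\ #|I| = (N ^ r)%N, independent_on (Z r) F &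
        forall a, laurent (V := k^o) (wt_bounded (r * (N * B))) (fun t => av_eval (F a) (h t))].
  have [I [F [cI indF FL]]] := H e (leqnn e).
  rewrite -cI; apply: leq_trans (laurent_bounded_le FL _) _.
    move=> c c0; apply: indF => x Zx; have [[S ZS] _ _] := irr e (leqnn e).
    by have [/hX[t <-] _] := (ZS x).1 Zx; apply: c0.
  case: (m) => [|m']; first by rewrite !expn0.
  by rewrite leq_exp2r //; nia.
elim: r => [_|r IH re].
  exists unit, (fun _ => 1); split; first by rewrite card_unit.
    have [_ [x0 Zx0] _] := irr 0%N (leq0n e).
    move=> c /(_ x0 Zx0); rewrite (bigD1 tt) //= big1 ?addr0 => [|[] //].
    by rewrite /av_eval meval1 mulr1 => c0 [].
  move=> _; rewrite mul0n; apply: eq_laurent (laurent_cst _ wt_bounded0) => t.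
  by rewrite /av_eval meval1.
have [I [F [cI indF FL]]] := IH (ltnW re).
have [ZZ _] := lt r re; have [P0 P1] := PP (Ordinal re).
exists (I * 'I_N)%type, (fun aj : I * 'I_N => F aj.1 * P (Ordinal re) ^+ aj.2); split.
- by rewrite card_prod cI card_ord expnSr.
- exact: independent_step (irr _ re) ZZ P0 P1 indF.
move=> [a j] /=.
have XL d : laurent (V := k^o) (wt_bounded (d * B)) (fun t => av_eval (P (Ordinal re) ^+ d) (h t)).
  elim: d => [|d XL].
    by rewrite mul0n; apply: eq_laurent (laurent_cst _ wt_bounded0) => t; rewrite /av_eval meval1.
  apply: eq_laurent (laurentM (A := k^o) _ (PB (Ordinal re)) XL) => [t|w w'].
    by rewrite exprS av_evalM.
  by rewrite mulSn; apply: wt_boundedD.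
apply: eq_laurent (laurentM (A := k^o) _ (FL a) (XL j)) => [t|w w' wB wB'].
  by rewrite av_evalM.
move=> i; have := wt_boundedD wB wB' i; move/leq_trans; apply.
by have := ltn_ord j; nia.
Qed.

End LaurentDegree.

(** * The grading attached to a torus in the automorphism group *)

Section TorusInAut.
Variables (k : fieldType) (n : nat) (Delta : simplicial_complex n).
Hypothesis char0 : [pchar k] =i pred0.
Local Notation R := (SRring k Delta).
Local Notation pi := (@SRpi k n Delta).
Local Notation xb := (@xbar k n Delta).

Lemma torus_coord_laurent m (j : av_idx (torus_var k m)) :
  laurent (V := k^o) (fun _ => True) (fun t => av_coord j t).
Proof.
case: j => i /=.
- apply: eq_laurent (laurent_chi (V := k^o) (w := delta_mx 0 i) 1 I) => t.
  by rewrite chi_delta -[_ *: _]/(_ * _) mulr1.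
- apply: eq_laurent (laurent_chi (V := k^o) (w := - delta_mx 0 i) 1 I) => t.
  by rewrite chiN chi_delta -[_ *: _]/(_ * _) mulr1.
Qed.

Lemma regular_laurent m (f : torus k m -> k) :
  regular (torus_var k m) f -> laurent (V := k^o) (fun _ => True) f.
Proof.
case=> P fP; have -> : f = (fun t => av_eval P t) by apply/funext => t; apply: fP.
by apply: laurent_meval => // i; apply: torus_coord_laurent.
Qed.

Lemma deg_le_expand d (a : R) : deg_le d a ->
  a = \sum_(M : 'X_{1..n < d.+1}) coef M a *: pi 'X_[M].
Proof.
move=> [p <- pd]; rewrite {1}(mpolywE pd) raddf_sum; apply: eq_bigr => M _ /=.
rewrite SRpiZ; have [MD|MD] := boolP (msupport M \in faces Delta).
  by rewrite coef_pi MD.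
by rewrite (SRpi_eq0 _ _).2 ?scaler0 //; apply: mono_nonface.
Qed.

Section OneTorus.
Variables (m d : nat) (D : AutX k Delta -> Prop) (h : torus k m -> AutX k Delta).
Hypothesis iso : alg_group_iso (torus_var k m) (subvariety (AutX_filt k Delta d) D) h.
Hypothesis Dd : forall f, D f -> AutX_piece d f.

Let hM s t : h (s * t)%g = (h s * h t)%g.
Proof. by have [hM _ _] := iso; apply: hM. Qed.

Let h1 : h 1%g = 1%g.
Proof. by apply: (mulgI (h 1%g)); rewrite -hM !mulg1. Qed.

Let hV t : h t^-1%g = (h t)^-1%g.
Proof. by apply: (mulgI (h t)); rewrite -hM !mulgV h1. Qed.

Let hD t : D (h t).
Proof. by have [_ [hD _] _] := iso; apply: hD. Qed.

Lemma torus_iso_surj f : D f -> exists t, h t = f.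
Proof. by have [_ _ [h' [_ _ hh']]] := iso => Df; exists (h' f); apply: hh'. Qed.

Lemma torus_iso_laurent (j : av_idx (AutX_filt k Delta d)) :
  laurent (V := k^o) (fun _ => True) (fun t => av_coord j (h t)).
Proof. by have [_ [_ hr] _] := iso; apply: regular_laurent; apply: hr. Qed.

(** h t has degree at most d for all t, so finitely many coefficients describe
    h t (x_i). *)
Lemma orbit_laurent i : laurent (fun _ => True) (fun t => h t (xb i)).
Proof.
have E t := deg_le_expand (Dd (hD t) i).1.
have -> : (fun t => h t (xb i)) =
    (fun t => \sum_(M : 'X_{1..n < d.+1}) coef M (h t (xb i)) *: pi 'X_[M]).
  by apply/funext.
apply: laurent_sum => M _; apply: laurent_scale.
exact: (torus_iso_laurent (true, i, M)).
Qed.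

Lemma torus_weight_dec : exists D : weight_dec h, spans_weights D.
Proof.
have [s sE] : exists s : 'I_n -> seq ('rV[int]_m * R),
    forall i t, h t (xb i) = \sum_(p <- s i) chi p.1 t *: p.2.
  suff H i : exists s : seq ('rV[int]_m * R),
      forall t, h t (xb i) = \sum_(p <- s) chi p.1 t *: p.2.
    by have [s sE] := choice H; exists s.
  by have [s _ sE] := orbit_laurent i; exists s.
pose u i := lcoef (s i).
pose W := undup (0 :: flatten [seq lsupp (s i) | i <- enum 'I_n]).
have u_in i p : p \in s i -> p.1 \in W.
  move=> /mem_lsupp ps; rewrite mem_undup inE; apply/orP; right.
  by apply/flatten_mapP; exists i; rewrite ?mem_enum.
have u_out i w : w \notin W -> u i w = 0.
  move=> wW; apply: lcoef_notin; apply: contra wW => ws.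
  rewrite mem_undup inE; apply/orP; right.
  by apply/flatten_mapP; exists i; rewrite ?mem_enum.
have W0 : 0 \in W by rewrite mem_undup inE eqxx.
have u_sum i : xb i = \sum_(w <- W) u i w.
  transitivity (\sum_(p <- s i) p.2).
    have := sE i 1%g; rewrite h1 /= => ->.
    by apply: eq_bigr => p _; rewrite chi1 scale1r.
  by apply: (lsum (f := fun _ x => x)) => //; [exact: undup_uniq | exact: u_in].
have u_wt i w : wtvec h w (u i w).
  move=> t; pose r := [seq (p.1, h t p.2 - chi p.1 t *: p.2) | p <- s i].
  have r0 t' : \sum_(p <- r) chi p.1 t' *: p.2 = 0.
    have := hM t t'; move/(congr1 (fun f : AutX k Delta => f (xb i))).
    rewrite /= !sE raddf_sum /= big_map => /eqP; rewrite eq_sym -subr_eq0 -sumrB.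
    move=> /eqP e; rewrite -[RHS]e; apply: eq_bigr => p _ /=.
    by rewrite scalerBr [in RHS]linearZ /= chiM scalerA [_ * chi _ t]mulrC.
  have := lindep char0 r0 w; rewrite /lcoef big_map /= sumrB => /eqP.
  rewrite subr_eq0 => /eqP e; rewrite /u /lcoef raddf_sum /= e scaler_sumr.
  by apply: eq_bigr => p /eqP ->.
exists (WeightDec (undup_uniq _) W0 u_out u_sum u_wt).
move=> L L0 LD LN Lu j; have [_ _ [h' [[_ hr'] h'h _]]] := iso.
have hu t i : h t (xb i) = \sum_(w <- W) chi w t *: u i w.
  by rewrite u_sum raddf_sum; apply: eq_bigr => w _; apply: u_wt.
(* Both h t and its inverse h (t^-1) have coordinates that are Laurent
   polynomials with exponents in the subgroup L. *)
have coordL (a : av_idx (AutX_filt k Delta d)) :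
    laurent (V := k^o) L (fun t => av_coord a (h t)).
  case: a => [[b i] M]; pose f t : R := if b then h t (xb i) else h t^-1%g (xb i).
  have -> : (fun t => av_coord ((b, i, M) : av_idx (AutX_filt k Delta d)) (h t)) =
            (fun t => coef M (f t)).
    by apply/funext => t; rewrite /f /=; case: (b); rewrite ?hV.
  have -> : (fun t => coef M (f t)) =
     (fun t => \sum_(w <- W) (chi (if b then w else - w) t *: (coef M (u i w) : k^o))).
    apply/funext => t; rewrite /f; case: (b); rewrite hu raddf_sum; apply: eq_bigr => w _ /=.
      by rewrite linearZ.
    by rewrite linearZ chiV.
  apply: laurent_sum => w _; have [u0|u0] := eqVneq (u i w) 0.
    have -> : (fun t => chi (if b then w else - w) t *: (coef M (u i w) : k^o)) = (fun=> 0).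
      by apply/funext => t; rewrite u0 raddf0 scaler0.
    exact: laurent_cst.
  have Lw := Lu i w u0; apply: laurent_chi; case: (b) => //; exact: LN.
(* The j-th coordinate of t is a regular function of h t, so its exponent lies
   in L. *)
have [P hP] := hr' (inl j).
have [r rL rE] : laurent (V := k^o) L (fun t => chi (delta_mx 0 j) t).
  have -> : (fun t => chi (delta_mx 0 j) t) = (fun t => av_eval P (h t)).
    apply/funext => t; rewrite -(hP _ (hD t)) chi_delta /= h'h //.
  by apply: laurent_meval => // a; apply: coordL.
pose r' := (delta_mx 0 j, -1 : k^o) :: r.
have r0 t : \sum_(p <- r') chi p.1 t *: p.2 = 0.
  by rewrite big_cons -rE /= scalerN -[_ *: _]/(_ * _) mulr1 addNr.
have := lindep char0 r0 (delta_mx 0 j); rewrite lcoef_cons eqxx /= => /eqP.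
have [jr|/lcoef_notin ->] := boolP (delta_mx 0 j \in lsupp r).
  by move: jr; rewrite mem_undup => /mapP[p pr ->] _; apply: rL.
by rewrite addr0 oppr_eq0 oner_eq0.
Qed.

End OneTorus.
End TorusInAut.

(** * The standard torus, and the theorem *)

Section StandardTorus.
Variables (k : fieldType) (n : nat) (Delta : simplicial_complex n).
Local Notation R := (SRring k Delta).
Local Notation pi := (@SRpi k n Delta).
Local Notation xb := (@xbar k n Delta).

Lemma torus_autM s t :
  torus_aut k Delta (s * t)%g = (torus_aut k Delta s * torus_aut k Delta t)%g.
Proof. by apply: algaut_ext => a /=; rewrite torus_actM. Qed.

Lemma torus_aut1 : torus_aut k Delta 1%g = 1%g.
Proof. by apply: algaut_ext => a /=; rewrite torus_act1. Qed.

Lemma torus_autV t : torus_aut k Delta t^-1%g = (torus_aut k Delta t)^-1%g.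
Proof. exact: algaut_ext. Qed.

Lemma T0_subgroup : is_subgroup (T0 k Delta).
Proof.
split; first by exists 1%g; rewrite torus_aut1.
  by move=> _ _ [s ->] [t ->]; exists (s * t)%g; rewrite torus_autM.
by move=> _ [t ->]; exists t^-1%g; rewrite torus_autV.
Qed.

Lemma deg_le_scale_xbar (c : k) i : deg_le 1 (c *: xb i).
Proof.
exists (c *: 'X_i); first by rewrite SRpiZ.
by apply: leq_trans (msizeZ_le _ _) _; rewrite msizeX mdeg1.
Qed.

Lemma torus_aut_piece t : AutX_piece 1 (torus_aut k Delta t).
Proof. by move=> i /=; rewrite !torus_act_xbar; split; apply: deg_le_scale_xbar. Qed.

Lemma bdeg1 (i : 'I_n) : (mdeg U_(i)%MM < 2)%N.
Proof. by rewrite mdeg1. Qed.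

Lemma deg_le1_diag a i : deg_le 1 a ->
  (forall M : 'X_{1..n < 2}, (M : 'X_{1..n}) != U_(i)%MM -> coef M a = 0) ->
  a = coef U_(i)%MM a *: xb i.
Proof.
move=> ad a0; rewrite {1}(deg_le_expand ad) (bigD1 (BMultinom (bdeg1 i))) //=.
rewrite big1 ?addr0 // => M MU; rewrite a0 ?scale0r //.
Qed.

Lemma coef_scale_xbar (c : k) M i : coef M (c *: xb i) = c * (M == U_(i)%MM)%:R.
Proof. by rewrite linearZ /= coef_xbar. Qed.

Lemma xbar_neq0 i : xb i != 0.
Proof.
apply/eqP => /(congr1 (coef U_(i)%MM)); rewrite coef_xbar eqxx raddf0 => /eqP.
by rewrite oner_eq0.
Qed.

(** In degree 1 the equations say that f and its inverse have diagonal coefficient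
    matrices and no constant terms. *)
Lemma T0_closed : closed_subset (AutX_filt k Delta 1) (T0 k Delta).
Proof.
exists (fun P => exists b i (M : 'X_{1..n < 2}), (M : 'X_{1..n}) != U_(i)%MM /\
  P = 'X_(enum_rank ((b, i, M) : av_idx (AutX_filt k Delta 1)))).
move=> f; split=> [[t ->]|[fd fS]].
  split; first exact: torus_aut_piece.
  move=> _ [b [i [M [MU ->]]]]; rewrite /av_eval mevalXU enum_rankK /=.
  by rewrite -/(coef _ _); case: b => /=;
    rewrite torus_act_xbar coef_scale_xbar (negPf MU) mulr0.
have f0 b i (M : 'X_{1..n < 2}) : (M : 'X_{1..n}) != U_(i)%MM ->
    coef M ((if b then f : R -> R else aut_inv f) (xb i)) = 0.
  move=> MU; have := fS _ (ex_intro _ b (ex_intro _ i (ex_intro _ M (conj MU erefl)))).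
  by rewrite /av_eval mevalXU enum_rankK.
pose c i := coef U_(i)%MM (f (xb i)).
have fE i : f (xb i) = c i *: xb i.
  by apply: deg_le1_diag (fd i).1 _ => M; apply: (f0 true).
have c0 i : c i != 0.
  apply: contraNneq (xbar_neq0 i) => ci; have := fE i; rewrite ci scale0r.
  by move=> /(congr1 (aut_inv f)); rewrite aut_funK raddf0 => ->.
exists [ffun i => exist _ (c i) (c0 i)]; apply: algaut_ext.
apply: (@eq_lrmorph_SR _ _ _ _ f (torus_act _)) => i.
by rewrite /= torus_act_xbar ffunE fE.
Qed.

Definition torus_param (f : AutX k Delta) : torus k n :=
  [ffun i => insubd (kstar_one k) (coef U_(i)%MM (f (xb i)))].

Lemma torus_paramK t : torus_param (torus_aut k Delta t) = t.
Proof.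
apply/ffunP => i; rewrite ffunE /= torus_act_xbar coef_scale_xbar eqxx mulr1.
exact: valKd.
Qed.

Lemma T0_iso : alg_group_iso (torus_var k n)
  (subvariety (AutX_filt k Delta 1) (T0 k Delta)) (torus_aut k Delta).
Proof.
split; first by move=> s t _ _; apply: torus_autM.
  split; first by move=> t _; exists t.
  move=> [[b i] M].
  pose j : av_idx (torus_var k n) := if b then inl i else inr i.
  exists (((M : 'X_{1..n}) == U_(i)%MM)%:R *: 'X_(enum_rank j)) => t _.
  rewrite /av_eval mevalZ mevalXU enum_rankK /= -/(coef _ _) /j.
  by case: (b) => /=; rewrite torus_act_xbar coef_scale_xbar mulrC //= ffunE.
exists torus_param; split; last 2 first.
- by move=> t _; rewrite torus_paramK.
- by move=> _ [t ->]; rewrite torus_paramK.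
split=> // -[i|i].
- exists ('X_(enum_rank ((true, i, BMultinom (bdeg1 i)) : av_idx (AutX_filt k Delta 1)))).
  move=> _ [t ->]; rewrite torus_paramK /av_eval mevalXU enum_rankK /= -/(coef _ _).
  by rewrite torus_act_xbar coef_scale_xbar eqxx mulr1.
exists ('X_(enum_rank ((false, i, BMultinom (bdeg1 i)) : av_idx (AutX_filt k Delta 1)))).
move=> _ [t ->]; rewrite torus_paramK /av_eval mevalXU enum_rankK /= -/(coef _ _).
by rewrite torus_act_xbar coef_scale_xbar eqxx mulr1 ffunE.
Qed.

End StandardTorus.

Section Tori.
Variables (k : fieldType) (n : nat) (Delta : simplicial_complex n).
Hypothesis char0 : [pchar k] =i pred0.

Lemma torus_chain_le m d D (h : torus k m -> AutX k Delta) :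
  alg_group_iso (torus_var k m) (subvariety (AutX_filt k Delta d) D) h ->
  forall e, has_chain (subvariety (AutX_filt k Delta d) D) e -> (e <= m)%N.
Proof.
move=> iso e; apply: (@chain_length_le _ _ _ _ h).
- exact: torus_iso_laurent iso.
- exact: torus_iso_surj iso.
Qed.

Lemma torus_rank m d D (h : torus k m -> AutX k Delta) :
  (forall f, D f -> AutX_piece d f) ->
  alg_group_iso (torus_var k m) (subvariety (AutX_filt k Delta d) D) h -> (m <= n)%N.
Proof.
by move=> Dd iso; have [W sW] := torus_weight_dec char0 iso Dd; apply: torus_rank_le sW.
Qed.

Lemma torus_conjugate d D (h : torus k n -> AutX k Delta) :
  (forall f, D f -> AutX_piece d f) ->
  alg_group_iso (torus_var k n) (subvariety (AutX_filt k Delta d) D) h ->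
  conjugate D (T0 k Delta).
Proof.
move=> Dd iso; have [W sW] := torus_weight_dec char0 iso Dd.
have [g [g1 g2]] := linearize char0 sW; exists g => f; split.
  move=> /(torus_iso_surj iso)[t <-]; have [s E] := g1 t.
  by exists (torus_aut k Delta s); [exists s | rewrite -E mulgK].
move=> [_ [s ->] ->]; have [t <-] := g2 s; rewrite mulgK.
by have [_ [hD _] _] := iso; apply: hD.
Qed.

End Tori.

Theorem theorem3p16 (k : closedFieldType) (n : nat)
    (Delta : simplicial_complex n) (char0 : [pchar k]%R =i pred0) :
  [/\ exists d : nat,
        alg_subgroup (AutX_filt k Delta) d (T0 k Delta) /\
        alg_group_iso (torus_var k n)
          (subvariety (AutX_filt k Delta d) (T0 k Delta)) (torus_aut k Delta),
      forall (d : nat) (D : AutX k Delta -> Prop),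
        is_torus (AutX_filt k Delta) d D ->
        dim_le (subvariety (AutX_filt k Delta d) D) n
    & forall (d : nat) (D : AutX k Delta -> Prop),
        is_torus (AutX_filt k Delta) d D ->
        has_dim (subvariety (AutX_filt k Delta d) D) n ->
        conjugate D (T0 k Delta)].
Proof.
have piece d (D : AutX k Delta -> Prop) : alg_subgroup (AutX_filt k Delta) d D ->
    forall f, D f -> AutX_piece d f.
  by move=> [_ [S DS]] f /DS[].
split.
- exists 1%N; split; [split; [exact: T0_subgroup | exact: T0_closed] | exact: T0_iso].
- move=> d D [/piece Dd [m [h iso]]] e /(torus_chain_le iso) em.
  exact: leq_trans em (torus_rank char0 Dd iso).
move=> d D [/piece Dd [m [h iso]]] [/(torus_chain_le iso) nm _].
have mn : m = n by apply/eqP; rewrite eqn_leq nm (torus_rank char0 Dd iso).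
by case: _ / (esym mn) h iso => h iso; apply: torus_conjugate Dd iso.
Qed.
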